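(* Let $\alpha,M>0$ and $0<M_1<M_0$. For each sample size $n$ let $p=p_n$, $p_0=p_{0,n}$ and $k=k_n$ be positive integers with $k<p_0<p$, let $\epsilon_n>0$, let $\Sigma_0\in\mathcal F_{p,\alpha}(M,M_0,M_1)$, and let $Z_1,\ldots,Z_n$ be i.i.d. $N_p(0,\Sigma_0)$ with $S_n=n^{-1}\sum_{i=1}^n Z_iZ_i^T$. If $k\vee\log p=o(n)$, $\epsilon_n=O(1)$ and $\lfloor k/2\rfloor>\{4M/\lambda_{\min}(\Sigma_0)\}^{1/\alpha}$, then there exist positive constants $C$ and $\lambda$ depending only on $M,M_0,M_1$ and $\alpha$ such that $$E_{\Sigma_0}\Big(\big\|\psi(\Sigma_0)-\psi\{T_k^{(\epsilon_n)}(S_n)\}\big\|^2\Big)\le C\Big\{k^{-2\alpha}+\frac{k+\log p}{n}+\epsilon_n^2+\frac{p^{1/2}5^{k/2}\exp(-\lambda n)}{\epsilon_n^2}\Big\}$$ for all sufficiently large $n$.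
   Context: $\mathcal C_p$ is the set of $p\times p$ (symmetric) positive definite matrices; $\lambda_{\min},\lambda_{\max}$ are the smallest and largest eigenvalues; $\|\cdot\|$ is the spectral norm; $x\vee y=\max(x,y)$. Bandable class: $\mathcal F_{p,\alpha}(M,M_0,M_1)=\{\Sigma=(\sigma_{ij})\in\mathcal C_p:\ \max_j\sum_{i:|i-j|\ge k}|\sigma_{ij}|\le Mk^{-\alpha}\ \forall k\ge1,\ \lambda_{\max}(\Sigma)\le M_0,\ \lambda_{\min}(\Sigma)\ge M_1\}$. Conditional mean operator: for a $p\times p$ matrix $A$, $A_{XX}$ is the block with rows $1,\ldots,p_0$ and columns $1,\ldots,p_0$, and $A_{YX}$ is the block with rows $p_0+1,\ldots,p$ and columns $1,\ldots,p_0$; $\psi(\Sigma)=\Sigma_{YX}(\Sigma_{XX})^{-1}$ for $\Sigma\in\mathcal C_p$. Tapering: $T_k(\Sigma)=(w^{(k)}_{ij}\sigma_{ij})$ with $w^{(k)}_{ij}=1$ if $|i-j|\le k/2$, $w^{(k)}_{ij}=2-\frac{|i-j|}{k/2}$ if $k/2<|i-j|<k$, and $w^{(k)}_{ij}=0$ otherwise. Adjusted tapering: $T_k^{(\epsilon)}(\Sigma)=T_k(\Sigma)+([\epsilon-\lambda_{\min}\{T_k(\Sigma)\}]\vee0)I_p$. *)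

(* Defs.v *)
From HB Require Import structures.
From mathcomp Require Import all_boot all_order all_algebra.
From mathcomp Require Import all_classical all_reals all_analysis.

Set Implicit Arguments.
Unset Strict Implicit.
Unset Printing Implicit Defensive.

Import Order.TTheory GRing.Theory Num.Theory.
Import numFieldNormedType.Exports.

Local Open Scope classical_set_scope.
Local Open Scope ring_scope.

Section Matrices.
Context {R : realType}.

Definition lambda_min (p : nat) (A : 'M[R]_p) : R := inf [set a | eigenvalue A a].

Definition lambda_max (p : nat) (A : 'M[R]_p) : R := sup [set a | eigenvalue A a].

Definition norm2 (m : nat) (x : 'cV[R]_m) : R :=
  Num.sqrt (\sum_(i < m) x i 0 ^+ 2).

(* The library norm `|A| on matrices is the largest absolute entry, hence this
   separate operator norm induced by the Euclidean norms. *)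
Definition spectral_norm (m n : nat) (A : 'M[R]_(m, n)) : R :=
  sup [set norm2 (A *m x) | x in [set x : 'cV[R]_n | norm2 x = 1]].

Definition posdef (p : nat) (A : 'M[R]_p) : Prop :=
  A^T = A /\ forall x : 'cV[R]_p, x != 0 -> 0 < (x^T *m A *m x) 0 0.

Definition idist (p : nat) (i j : 'I_p) : nat := `|(i : nat)%:Z - (j : nat)%:Z|%N.

Definition bandable (p : nat) (alpha M M0 M1 : R) : set 'M[R]_p :=
  [set S | [/\ posdef S,
    forall k : nat, (1 <= k)%N ->
      \big[Num.max/0]_(j < p) (\sum_(i < p | (k <= idist i j)%N) `|S i j|)
        <= M * k%:R `^ (- alpha),
    lambda_max S <= M0 & M1 <= lambda_min S]].

(* The dimension is p = p0 + q: the XX block is the upper left one and the YX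
   block the lower left one. *)
Definition psi (p0 q : nat) (A : 'M[R]_(p0 + q)) : 'M[R]_(q, p0) :=
  dlsubmx A *m invmx (ulsubmx A).

Definition taper_weight (p k : nat) (i j : 'I_p) : R :=
  let h := (idist i j)%:R in
  if h <= k%:R / 2 then 1
  else if h < k%:R then 2 - h / (k%:R / 2)
  else 0.

Definition taper (p k : nat) (S : 'M[R]_p) : 'M[R]_p :=
  \matrix_(i, j) (taper_weight k i j * S i j).

Definition adjusted_taper (p k : nat) (eps : R) (S : 'M[R]_p) : 'M[R]_p :=
  taper k S + Num.max (eps - lambda_min (taper k S)) 0 *: 1%:M.

End Matrices.

(* Random vectors are represented as tuples, for which the library provides the
   product (Borel) sigma-algebra. *)
Section RandomVectors.
Context {R : realType} {d : measure_display} {T : measurableType d}.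
Variable P : probability T R.

Definition tuple_col (p : nat) (t : p.-tuple R) : 'cV[R]_p := \col_j tnth t j.

(* N_p(mu, S) for a positive definite S: every nontrivial linear combination
   u^T Z is N(u^T mu, u^T S u).  The second parameter of normal_prob is the
   standard deviation; u = 0 is left out because normal_prob m 0 is not a Dirac
   mass in the library. *)
Definition mvnormal (p : nat) (mu : 'cV[R]_p) (S : 'M[R]_p)
    (Z : {RV P >-> p.-tuple R}) : Prop :=
  forall u : 'cV[R]_p, u != 0 -> forall A : set R, measurable A ->
    P ((fun w => (u^T *m tuple_col (Z w)) 0 0) @^-1` A) =
    normal_prob ((u^T *m mu) 0 0) (Num.sqrt ((u^T *m S *m u) 0 0)) A.

Definition mutually_independent (n p : nat) (Z : 'I_n -> {RV P >-> p.-tuple R}) : Prop :=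
  forall (J : {set 'I_n}) (A : 'I_n -> set (p.-tuple R)),
    (forall i, measurable (A i)) ->
    P [set w | forall i, i \in J -> A i (Z i w)] =
    (\prod_(i in J) P (Z i @^-1` A i))%E.

Definition sample_cov (n p : nat) (Z : 'I_n -> {RV P >-> p.-tuple R}) (w : T) : 'M[R]_p :=
  n%:R^-1 *: \sum_(i < n) (tuple_col (Z i w) *m (tuple_col (Z i w))^T).

End RandomVectors.

(* Main.v *)
(** Write E = S_n - Sigma_0.  The resolvent identity
      psi(A) - psi(S) = ((A - S)_YX - S_YX S_XX^-1 (A - S)_XX) A_XX^-1
    bounds the loss by a multiple of (2 delta + eps) / max(eps, lambda_min - delta)
    with delta = |T_k(S_n) - Sigma_0|: the loss is of order delta + eps when delta
    is small, and at most of order 1 + delta / eps otherwise.  Here delta is at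
    most the bias, which is O(k^-alpha) because Sigma_0 is bandable, plus |T_k(E)|.
    The tapering weights are a combination of the kernels (1 - |i-j|/k)_+ and
    (1 - 2|i-j|/k)_+, each an average of indicators of windows of at most k
    consecutive indices, so |T_k(E)| is controlled by the blocks of E on O(p)
    windows, hence by y^T E y for y in a finite set of cardinality p * O(1)^k.
    For each such y, n y^T E y is a centered sum of squares of n independent
    Gaussian variables, and a union bound on its exponential moments (at two
    different scales) yields the rate (k + log p)/n for the mean square and an
    exponentially small contribution of the event where delta is large. *)

Require Import Defs.
From HB Require Import structures.
From mathcomp Require Import all_boot all_order all_algebra.
From mathcomp Require Import all_classical all_reals all_analysis measurable_realfun.
From mathcomp Require Import ring lra zify.

Set Implicit Arguments.
Unset Strict Implicit.
Unset Printing Implicit Defensive.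

Import Order.TTheory GRing.Theory Num.Theory.
Import numFieldNormedType.Exports.

Local Open Scope classical_set_scope.
Local Open Scope ring_scope.

(** * Euclidean vectors and operator bounds *)

Section InnerProduct.
Context {R : realType}.

Definition dot (m : nat) (x y : 'cV[R]_m) : R := (x^T *m y) 0 0.

Lemma dotE m (x y : 'cV[R]_m) : dot x y = \sum_i x i 0 * y i 0.
Proof. by rewrite /dot mxE; apply: eq_bigr => i _; rewrite mxE. Qed.

Lemma dotC m (x y : 'cV[R]_m) : dot x y = dot y x.
Proof. by rewrite !dotE; apply: eq_bigr => i _; rewrite mulrC. Qed.

Lemma dotDl m (x y z : 'cV[R]_m) : dot (x + y) z = dot x z + dot y z.
Proof. by rewrite /dot linearD mulmxDl mxE. Qed.

Lemma dotDr m (x y z : 'cV[R]_m) : dot z (x + y) = dot z x + dot z y.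
Proof. by rewrite dotC dotDl !(dotC z). Qed.

Lemma dotZl m a (x y : 'cV[R]_m) : dot (a *: x) y = a * dot x y.
Proof. by rewrite /dot linearZ -scalemxAl mxE. Qed.

Lemma dotZr m a (x y : 'cV[R]_m) : dot x (a *: y) = a * dot x y.
Proof. by rewrite dotC dotZl dotC. Qed.

Lemma dotNl m (x y : 'cV[R]_m) : dot (- x) y = - dot x y.
Proof. by rewrite -scaleN1r dotZl mulN1r. Qed.

Lemma dotNr m (x y : 'cV[R]_m) : dot x (- y) = - dot x y.
Proof. by rewrite dotC dotNl dotC. Qed.

Lemma dot0l m (x : 'cV[R]_m) : dot 0 x = 0.
Proof. by rewrite -(scale0r x) dotZl mul0r. Qed.

Lemma dot_mull m n (A : 'M[R]_(n, m)) x y : dot (A *m x) y = dot x (A^T *m y).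
Proof. by rewrite /dot trmx_mul mulmxA. Qed.

Lemma dot_ge0 m (x : 'cV[R]_m) : 0 <= dot x x.
Proof. by rewrite dotE sumr_ge0 // => i _; rewrite -expr2 sqr_ge0. Qed.

Lemma dot_eq0 m (x : 'cV[R]_m) : (dot x x == 0) = (x == 0).
Proof.
apply/eqP/eqP => [|->]; last exact: dot0l.
rewrite dotE => /eqP; rewrite psumr_eq0 => [/allP x0|i _]; last first.
  by rewrite -expr2 sqr_ge0.
apply/colP => i; have := x0 i (mem_index_enum i).
by rewrite -expr2 sqrf_eq0 mxE => /eqP.
Qed.

Lemma dot_gt0 m (x : 'cV[R]_m) : x != 0 -> 0 < dot x x.
Proof. by move=> x0; rewrite lt0r dot_ge0 dot_eq0 x0. Qed.

Lemma norm2E m (x : 'cV[R]_m) : norm2 x = Num.sqrt (dot x x).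
Proof.
by rewrite /norm2 dotE; congr Num.sqrt; apply: eq_bigr => i _; rewrite expr2.
Qed.

Lemma sqr_norm2 m (x : 'cV[R]_m) : norm2 x ^+ 2 = dot x x.
Proof. by rewrite norm2E sqr_sqrtr // dot_ge0. Qed.

Lemma norm2_ge0 m (x : 'cV[R]_m) : 0 <= norm2 x.
Proof. exact: sqrtr_ge0. Qed.

Lemma le_norm2 m (x : 'cV[R]_m) c : 0 <= c -> (norm2 x <= c) = (dot x x <= c ^+ 2).
Proof. by move=> c0; rewrite -sqr_norm2 ler_sqr // nnegrE norm2_ge0. Qed.

Lemma quad_addZ m (B : 'M[R]_m) (x y : 'cV[R]_m) t : B^T = B ->
  dot (x + t *: y) (B *m (x + t *: y)) =
  dot x (B *m x) + 2 * t * dot x (B *m y) + t ^+ 2 * dot y (B *m y).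
Proof.
move=> Bs; rewrite mulmxDr !(dotDl, dotDr) -scalemxAr !(dotZl, dotZr).
have -> : dot y (B *m x) = dot x (B *m y) by rewrite dotC dot_mull Bs.
ring.
Qed.

(** The polynomial [a + 2 * t * b + t ^+ 2 * c] in [t] is nonnegative, and its value at the
    minimizer [- b / c] is [(a * c - b ^+ 2) / c]. Degenerate forms have to be covered: shifting a
    symmetric matrix by its smallest Rayleigh quotient leaves only a semidefinite form. *)
Lemma psd_cauchy_schwarz m (B : 'M[R]_m) (x y : 'cV[R]_m) : B^T = B ->
  (forall z, 0 <= dot z (B *m z)) ->
  dot x (B *m y) ^+ 2 <= dot x (B *m x) * dot y (B *m y).
Proof.
move=> Bs Bge0; have key t := Bge0 (x + t *: y).
have y0 := Bge0 y; have x0 := Bge0 x; move: key x0 y0.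
set a := dot x (B *m x); set b := dot x (B *m y); set c := dot y (B *m y).
move=> key a0 c0.
have {}key t : 0 <= a + 2 * t * b + t ^+ 2 * c.
  by have := key t; rewrite quad_addZ.
have [c_eq0|c_neq0] := eqVneq c 0.
  have [->|b0] := eqVneq b 0; first by rewrite expr0n mulr_ge0.
  (* With [c = 0] the polynomial is affine in [t], and this [t] gives it the value -1. *)
  have := key (- (a + 1) / (2 * b)); rewrite c_eq0.
  have -> : a + 2 * (- (a + 1) / (2 * b)) * b + (- (a + 1) / (2 * b)) ^+ 2 * 0 = -1.
    by field.
  by rewrite ler0N1.
have cp : 0 < c by rewrite lt0r c_neq0.
have := key (- b / c).
have -> : a + 2 * (- b / c) * b + (- b / c) ^+ 2 * c = (a * c - b ^+ 2) / c.
  by field.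
by rewrite pmulr_lge0 ?invr_gt0 // subr_ge0.
Qed.

Lemma cauchy_schwarz m (x y : 'cV[R]_m) : dot x y ^+ 2 <= dot x x * dot y y.
Proof.
have := @psd_cauchy_schwarz _ 1%:M x y; rewrite !mul1mx; apply; first exact: trmx1.
by move=> z; rewrite mul1mx dot_ge0.
Qed.

Lemma dot_le m (x y : 'cV[R]_m) : `|dot x y| <= norm2 x * norm2 y.
Proof.
rewrite -ler_sqr ?nnegrE ?mulr_ge0 ?norm2_ge0 //.
by rewrite exprMn !sqr_norm2 real_normK ?num_real // cauchy_schwarz.
Qed.

Lemma norm2D m (x y : 'cV[R]_m) : norm2 (x + y) <= norm2 x + norm2 y.
Proof.
rewrite le_norm2 ?addr_ge0 ?norm2_ge0 // !(dotDl, dotDr) sqrrD !sqr_norm2.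
have := le_trans (ler_norm _) (dot_le x y); rewrite (dotC y x); lra.
Qed.

Lemma norm2Z m a (x : 'cV[R]_m) : norm2 (a *: x) = `|a| * norm2 x.
Proof. by rewrite !norm2E dotZl dotZr mulrA -expr2 sqrtrM ?sqr_ge0 // sqrtr_sqr. Qed.

Lemma norm2N m (x : 'cV[R]_m) : norm2 (- x) = norm2 x.
Proof. by rewrite -scaleN1r norm2Z normrN1 mul1r. Qed.

Lemma norm2_eq0 m (x : 'cV[R]_m) : (norm2 x == 0) = (x == 0).
Proof. by rewrite -dot_eq0 -sqr_norm2 sqrf_eq0. Qed.

(** A predicate instead of a norm: it passes to sums, products and blocks without any handling of
    the supremum in [spectral_norm]. *)
Definition opbound (m n : nat) (A : 'M[R]_(m, n)) (c : R) : Prop :=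
  forall x, norm2 (A *m x) <= c * norm2 x.

Lemma opbound_mul m n l (A : 'M[R]_(m, n)) (B : 'M[R]_(n, l)) a b :
  0 <= a -> opbound A a -> opbound B b -> opbound (A *m B) (a * b).
Proof.
move=> a0 hA hB x; rewrite -mulmxA (le_trans (hA _)) // -mulrA ler_wpM2l //.
Qed.

Lemma opboundD m n (A B : 'M[R]_(m, n)) a b :
  opbound A a -> opbound B b -> opbound (A + B) (a + b).
Proof.
by move=> hA hB x; rewrite mulmxDl mulrDl (le_trans (norm2D _ _)) // lerD.
Qed.

Lemma opboundN m n (A : 'M[R]_(m, n)) a : opbound A a -> opbound (- A) a.
Proof. by move=> hA x; rewrite mulNmx norm2N. Qed.

Lemma spectral_norm_ge0 m n (A : 'M[R]_(m, n)) : 0 <= spectral_norm A.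
Proof.
rewrite /spectral_norm; set E := (X in sup X).
(* [sup] is 0 on the empty set, which occurs for [n = 0] since there is then no unit vector, and
   also on a set without supremum. *)
have [[y Ey]|/set0P/negP/negPn/eqP ->] := pselect (E !=set0); last by rewrite sup0.
have [hs|hs] := pselect (has_sup E); last by rewrite sup_out.
apply: le_trans (ub_le_sup hs.2 Ey); case: Ey => x _ <-; exact: norm2_ge0.
Qed.

Lemma spectral_norm_le m n (A : 'M[R]_(m, n)) c : 0 <= c -> opbound A c ->
  spectral_norm A <= c.
Proof.
move=> c0 hA; rewrite /spectral_norm; set E := (X in sup X).
have [ne|/set0P/negP/negPn/eqP ->] := pselect (E !=set0); last by rewrite sup0.
apply: ge_sup => // _ [x /= x1 <-]; by rewrite (le_trans (hA x)) // x1 mulr1.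
Qed.

Lemma opbound_dot m n (A : 'M[R]_(m, n)) c : 0 <= c ->
  (forall x y, dot y (A *m x) <= c * (norm2 x * norm2 y)) -> opbound A c.
Proof.
move=> c0 h x; have := h x (A *m x); rewrite -sqr_norm2 expr2 mulrA.
have [->|n0] := eqVneq (norm2 (A *m x)) 0; first by rewrite mulr_ge0 ?norm2_ge0.
by rewrite ler_pM2r // lt0r n0 norm2_ge0.
Qed.

(* Polarization, after normalizing both vectors. *)
Lemma sym_quad_opbound m (B : 'M[R]_m) c : 0 <= c -> B^T = B ->
  (forall x, `|dot x (B *m x)| <= c * dot x x) -> opbound B c.
Proof.
move=> c0 Bs h; apply: opbound_dot => // x y.
have [->|x0] := eqVneq x 0.
  by rewrite mulmx0 dotC dot0l mulr_ge0 // mulr_ge0 ?norm2_ge0.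
have [->|y0] := eqVneq y 0.
  by rewrite dot0l mulr_ge0 // mulr_ge0 ?norm2_ge0.
have a0 : 0 < norm2 x by rewrite lt0r norm2_ge0 norm2_eq0 x0.
have b0 : 0 < norm2 y by rewrite lt0r norm2_ge0 norm2_eq0 y0.
set t := norm2 x / norm2 y.
have t0 : 0 < t by rewrite divr_gt0.
have hp := le_trans (ler_norm _) (h (x + t *: y)).
have hm : - dot (x + (- t) *: y) (B *m (x + (- t) *: y)) <=
    c * dot (x + (- t) *: y) (x + (- t) *: y).
  by apply: le_trans (h _); rewrite -normrN ler_norm.
have id1 s : dot (x + s *: y) (x + s *: y) =
    dot x x + 2 * s * dot x y + s ^+ 2 * dot y y.
  rewrite !(dotDl, dotDr) !(dotZl, dotZr) (dotC y x); ring.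
rewrite !quad_addZ // !id1 in hp hm.
have -> : dot y (B *m x) = dot x (B *m y) by rewrite dotC dot_mull Bs.
have {hp hm} : 4 * t * dot x (B *m y) <= c * (2 * dot x x + 2 * t ^+ 2 * dot y y).
  lra.
rewrite -!sqr_norm2.
have -> : c * (2 * norm2 x ^+ 2 + 2 * t ^+ 2 * norm2 y ^+ 2) =
   4 * t * (c * (norm2 x * norm2 y)).
  by rewrite /t; field; rewrite gt_eqF.
by rewrite ler_pM2l // mulr_gt0.
Qed.

End InnerProduct.

(** * Extreme eigenvalues of symmetric matrices *)

Section RayleighQuotient.
Context {R : realType}.

(** The sum of all absolute entries is a crude bound; it serves where some finite positive bound is
    wanted, whatever its size. *)
Lemma opbound_exists m n (A : 'M[R]_(m, n)) : exists2 K, 0 < K & opbound A K.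
Proof.
exists (1 + \sum_i \sum_j `|A i j|).
  by rewrite ltr_pwDl // sumr_ge0 // => i _; rewrite sumr_ge0.
apply: opbound_dot => [|x y].
  by rewrite addr_ge0 // sumr_ge0 // => i _; rewrite sumr_ge0.
have coord l (z : 'cV[R]_l) i : `|z i 0| <= norm2 z.
  rewrite -ler_sqr ?nnegrE ?norm2_ge0 // sqr_norm2 real_normK ?num_real // dotE.
  rewrite (bigD1 i) //= expr2 lerDl sumr_ge0 // => j _.
  by rewrite -expr2 sqr_ge0.
rewrite dotE mulrDl mulr_suml ler_wpDl //; first by rewrite mul1r mulr_ge0 ?norm2_ge0.
apply: ler_sum => i _; rewrite mxE mulr_sumr mulr_suml; apply: ler_sum => j _.
rewrite (le_trans (ler_norm _)) // !normrM mulrCA ler_wpM2l // mulrC.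
by rewrite ler_pM.
Qed.

Lemma unit_vector_exists m : (0 < m)%N -> exists x : 'cV[R]_m, norm2 x = 1.
Proof.
case: m => // m _; exists (delta_mx 0 0).
apply/eqP; rewrite -(eqrXn2 (ltn0Sn 1)) ?norm2_ge0 // sqr_norm2 expr1n.
rewrite dotE (bigD1 0) //= big1 => [|i /negPf i0]; last by rewrite !mxE i0 mul0r.
by rewrite !mxE /= mulr1 addr0.
Qed.

Lemma quad_unit m (A : 'M[R]_m) (c : R) :
  (forall x, norm2 x = 1 -> c <= dot x (A *m x)) ->
  forall x, c * dot x x <= dot x (A *m x).
Proof.
move=> h x; have [->|x0] := eqVneq x 0; first by rewrite !dot0l mulr0.
have n0 : norm2 x != 0 by rewrite norm2_eq0.
have := h ((norm2 x)^-1 *: x).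
rewrite norm2Z ger0_norm ?invr_ge0 ?norm2_ge0 // mulVf // => /(_ erefl).
rewrite -scalemxAr dotZl dotZr mulrA -expr2 exprVn sqr_norm2 mulrC.
by rewrite ler_pdivlMr // dot_gt0.
Qed.

(* Were A - c invertible, the Cauchy-Schwarz inequality for this positive
   semidefinite form would bound the quotient away from its infimum c. *)
Lemma inf_rayleigh_eigenvalue m (A : 'M[R]_m) : (0 < m)%N -> A^T = A ->
  exists2 c, eigenvalue A c & forall x, c * dot x x <= dot x (A *m x).
Proof.
move=> m0 As; pose E := [set dot x (A *m x) | x in [set x : 'cV[R]_m | norm2 x = 1]].
have [u u1] := unit_vector_exists m0.
have E0 : E !=set0 by exists (dot u (A *m u)); exists u.
have [KA KA0 hKA] := opbound_exists A.
have Elb : has_lbound E.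
  exists (- KA) => _ [x /= x1 <-]; rewrite lerNl.
  apply: le_trans (ler_norm _) _; rewrite normrN (le_trans (dot_le _ _)) // x1 mul1r.
  by rewrite (le_trans (hKA x)) // x1 mulr1.
have qA : forall x, inf E * dot x x <= dot x (A *m x).
  by apply: quad_unit => x x1; apply: ge_inf => //; exists x.
exists (inf E) => //; apply: contrapT => /negP neig.
pose B := A - (inf E)%:M.
have qB z : dot z (B *m z) = dot z (A *m z) - inf E * dot z z.
  by rewrite mulmxBl mul_scalar_mx dotDr dotNr dotZr.
have Bs : B^T = B by rewrite linearB /= As tr_scalar_mx.
have Bge0 z : 0 <= dot z (B *m z) by rewrite qB subr_ge0.
have Bu : B \in unitmx.
  by rewrite -row_free_unit -kermx_eq0; move: neig; rewrite /eigenvalue negbK.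
have [K K0 hK] := opbound_exists B.
have [K1 K10 hK1] := opbound_exists (invmx B).
(* Cauchy-Schwarz for the form of [B] at [x] and [B *m x] gives [|B x|^4 <= (x . B x) (B x . B B x)
   <= (x . B x) K |B x|^2], and one factor [|B x|^2] cancels. *)
have Bx x : dot (B *m x) (B *m x) <= K * dot x (B *m x).
  have [->|y0] := eqVneq (B *m x) 0.
    by rewrite dot0l dotC dot0l mulr0.
  have := psd_cauchy_schwarz x (B *m x) Bs Bge0.
  have -> : dot x (B *m (B *m x)) = dot (B *m x) (B *m x) by rewrite dot_mull Bs.
  move=> h.
  have h2 : dot (B *m x) (B *m (B *m x)) <= K * dot (B *m x) (B *m x).
    apply: le_trans (ler_norm _) _; apply: le_trans (dot_le _ _) _.
    by rewrite -sqr_norm2 expr2 mulrCA ler_wpM2l ?norm2_ge0.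
  have := le_trans h (ler_wpM2l (Bge0 x) h2).
  by rewrite expr2 mulrA ler_pM2r ?dot_gt0 // mulrC.
have K2 : 0 < K1 ^+ 2 * K by rewrite mulr_gt0 // exprn_gt0.
(* Invertibility gives [|B x| >= 1 / K1] on unit vectors, so there the form of [B] is at least the
   positive constant [1 / (K1^2 K)]. *)
have low x : norm2 x = 1 -> inf E + (K1 ^+ 2 * K)^-1 <= dot x (A *m x).
  move=> x1; have d1 : dot x x = 1 by rewrite -sqr_norm2 x1 expr1n.
  have := hK1 (B *m x); rewrite mulKmx // x1 => h1.
  have h2 : 1 <= K1 ^+ 2 * dot (B *m x) (B *m x).
    by rewrite -sqr_norm2 -exprMn exprn_ege1.
  have := le_trans h2 (ler_wpM2l (sqr_ge0 _) (Bx x)).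
  by rewrite qB d1 mulr1 mulrA mulrC -ler_pdivrMr // div1r lerBrDl.
have : inf E + (K1 ^+ 2 * K)^-1 <= inf E.
  by apply: lb_le_inf => // _ [x x1 <-]; exact: low.
by rewrite gerDl leNgt invr_gt0 K2.
Qed.

Lemma eigenvalue_quad m (A : 'M[R]_m) a : A^T = A -> eigenvalue A a ->
  exists2 x, norm2 x = 1 & dot x (A *m x) = a.
Proof.
move=> As /eigenvalueP [v va v0]; have w0 : v^T != 0 by rewrite trmx_eq0.
have Aw : A *m v^T = a *: v^T by rewrite -[A in LHS]As -trmx_mul va linearZ.
have n0 : norm2 v^T != 0 by rewrite norm2_eq0.
exists ((norm2 v^T)^-1 *: v^T).
  by rewrite norm2Z ger0_norm ?invr_ge0 ?norm2_ge0 // mulVf.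
rewrite -scalemxAr Aw !(dotZl, dotZr) -sqr_norm2; by field.
Qed.

(** The existence of an eigenvalue makes [lambda_min] an infimum over a nonempty set instead of a
    default value. *)
Lemma le_lambda_min m (A : 'M[R]_m) c : (0 < m)%N -> A^T = A ->
  (forall x, c * dot x x <= dot x (A *m x)) -> c <= lambda_min A.
Proof.
move=> m0 As h; have [b be _] := inf_rayleigh_eigenvalue m0 As.
apply: lb_le_inf; first by exists b.
move=> a /= /(eigenvalue_quad As) [x x1 <-].
by have := h x; rewrite -sqr_norm2 x1 expr1n mulr1.
Qed.

Lemma lambda_min_quad m (A : 'M[R]_m) x : (0 < m)%N -> A^T = A ->
  lambda_min A * dot x x <= dot x (A *m x).
Proof.
move=> m0 As; have [b be hb] := inf_rayleigh_eigenvalue m0 As.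
apply: le_trans (hb x); rewrite ler_wpM2r ?dot_ge0 //.
apply: ge_inf => //; exists b => a /= /(eigenvalue_quad As) [y y1 <-].
by have := hb y; rewrite -sqr_norm2 y1 expr1n mulr1.
Qed.

(** The result on the smallest Rayleigh quotient is applied to [- A]. *)
Lemma lambda_max_quad m (A : 'M[R]_m) x : (0 < m)%N -> A^T = A ->
  dot x (A *m x) <= lambda_max A * dot x x.
Proof.
move=> m0 As; have NAs : (- A)^T = - A by rewrite linearN /= As.
have [b be hb] := inf_rayleigh_eigenvalue m0 NAs.
have {}be : eigenvalue A (- b).
  case/eigenvalueP: be => v; rewrite mulmxN => /eqP; rewrite eqr_oppLR => /eqP va v0.
  by apply/eigenvalueP; exists v; rewrite // scaleNr.
have {}hb y : dot y (A *m y) <= - b * dot y y.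
  by have := hb y; rewrite mulNmx dotNr mulNr lerNr.
apply: le_trans (hb x) _; rewrite ler_wpM2r ?dot_ge0 //.
apply: ub_le_sup => //; exists (- b) => a /= /(eigenvalue_quad As) [y y1 <-].
by have := hb y; rewrite -sqr_norm2 y1 expr1n mulr1.
Qed.

End RayleighQuotient.

(** * The conditional mean operator *)

Section ConditionalMean.
Context {R : realType}.

Lemma dot_col_mx m n (a c : 'cV[R]_m) (b d : 'cV[R]_n) :
  dot (col_mx a b) (col_mx c d) = dot a c + dot b d.
Proof. by rewrite /dot tr_col_mx mul_row_col mxE. Qed.

Lemma norm2_usubmx m n (z : 'cV[R]_(m + n)) : norm2 (usubmx z) <= norm2 z.
Proof.
rewrite le_norm2 ?norm2_ge0 // sqr_norm2 -{3 4}[z]vsubmxK dot_col_mx.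
by rewrite lerDl dot_ge0.
Qed.

Lemma norm2_dsubmx m n (z : 'cV[R]_(m + n)) : norm2 (dsubmx z) <= norm2 z.
Proof.
rewrite le_norm2 ?norm2_ge0 // sqr_norm2 -{3 4}[z]vsubmxK dot_col_mx.
by rewrite lerDr dot_ge0.
Qed.

Lemma norm2_col_mx0 m n (x : 'cV[R]_m) : norm2 (col_mx x (0 : 'cV[R]_n)) = norm2 x.
Proof. by rewrite !norm2E dot_col_mx dot0l addr0. Qed.

Lemma mulmx_col_mx0 m n (A : 'M[R]_(m + n)) (x : 'cV[R]_m) :
  A *m col_mx x (0 : 'cV[R]_n) = col_mx (ulsubmx A *m x) (dlsubmx A *m x).
Proof. by rewrite -{1}[A]submxK mul_block_col !mulmx0 !addr0. Qed.

Lemma opbound_ulsubmx m n (A : 'M[R]_(m + n)) c : opbound A c -> opbound (ulsubmx A) c.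
Proof.
move=> h x; have := h (col_mx x 0); rewrite norm2_col_mx0; apply: le_trans.
by have := norm2_usubmx (A *m col_mx x 0); rewrite mulmx_col_mx0 col_mxKu.
Qed.

Lemma opbound_dlsubmx m n (A : 'M[R]_(m + n)) c : opbound A c -> opbound (dlsubmx A) c.
Proof.
move=> h x; have := h (col_mx x 0); rewrite norm2_col_mx0; apply: le_trans.
by have := norm2_dsubmx (A *m col_mx x 0); rewrite mulmx_col_mx0 col_mxKd.
Qed.

Lemma quad_ulsubmx m n (A : 'M[R]_(m + n)) c :
  (forall x, c * dot x x <= dot x (A *m x)) ->
  forall x, c * dot x x <= dot x (ulsubmx A *m x).
Proof.
move=> h x; have := h (col_mx x 0).
by rewrite mulmx_col_mx0 !dot_col_mx !dot0l !addr0.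
Qed.

Lemma coercive_unitmx m (A : 'M[R]_m) c : 0 < c ->
  (forall x, c * dot x x <= dot x (A *m x)) -> A \in unitmx.
Proof.
move=> c0 h; rewrite -unitmx_tr -row_free_unit; apply/inj_row_free => v vA.
have : dot v^T (A *m v^T) <= 0.
  by rewrite -[A]trmxK -trmx_mul vA trmx0 dotC dot0l.
move=> /(le_trans (h _)); rewrite pmulr_rle0 // => h2.
have /eqP : dot v^T v^T == 0 by rewrite eq_le h2 dot_ge0.
by move/eqP; rewrite dot_eq0 trmx_eq0 => /eqP.
Qed.

Lemma coercive_opbound_invmx m (A : 'M[R]_m) c : 0 < c ->
  (forall x, c * dot x x <= dot x (A *m x)) -> opbound (invmx A) c^-1.
Proof.
move=> c0 h x; have Au := coercive_unitmx c0 h.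
have := h (invmx A *m x); rewrite mulKVmx // => h1.
have {}h1 := le_trans h1 (le_trans (ler_norm _) (dot_le _ _)).
have [->|n0] := eqVneq (norm2 (invmx A *m x)) 0.
  by rewrite mulr_ge0 ?norm2_ge0 // invr_ge0 ltW.
rewrite mulrC ler_pdivlMr // mulrC.
move: h1; rewrite -sqr_norm2 expr2 mulrA [leRHS]mulrC ler_pM2r //.
by rewrite lt0r n0 norm2_ge0.
Qed.

(** Only one inverse block of [A] enters the resolvent identity, whence the single factor [1 / m];
    the term [M0 / M1] bounds [S_YX S_XX^-1]. Hence [A] may be as close to singular as the
    adjustment by [eps] allows. *)
Lemma psi_lipschitz p0 q (A S : 'M[R]_(p0 + q)) b m M0 M1 :
  0 < m -> 0 < M1 -> 0 <= M0 -> 0 <= b -> opbound (A - S) b -> opbound S M0 ->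
  (forall x, m * dot x x <= dot x (A *m x)) ->
  (forall x, M1 * dot x x <= dot x (S *m x)) ->
  opbound (psi S - psi A) ((1 + M0 / M1) * b / m).
Proof.
move=> m0 M10 M00 b0 hAS hS hA hS1.
have uA := coercive_unitmx m0 (quad_ulsubmx hA).
have uS := coercive_unitmx M10 (quad_ulsubmx hS1).
have dE : psi S - psi A =
   - ((dlsubmx (A - S) + - (dlsubmx S *m (invmx (ulsubmx S) *m ulsubmx (A - S))))
     *m invmx (ulsubmx A)).
  have -> : dlsubmx (A - S) = dlsubmx A - dlsubmx S by apply/matrixP=> i j; rewrite !mxE.
  have -> : ulsubmx (A - S) = ulsubmx A - ulsubmx S by apply/matrixP=> i j; rewrite !mxE.
  rewrite /psi (mulmxBr (invmx _)) mulVmx // mulmxBr mulmx1 opprB addrA subrK.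
  by rewrite mulmxBl mulmxA -!mulmxA mulmxV // mulmx1 opprB.
rewrite dE; apply: opboundN; apply: opbound_mul.
- by rewrite mulr_ge0 // addr_ge0 // divr_ge0 // ltW.
- rewrite mulrDl mul1r; apply: opboundD; first exact: opbound_dlsubmx.
  apply: opboundN; rewrite -mulrA; apply: opbound_mul => //.
    exact: opbound_dlsubmx.
  apply: opbound_mul; first by rewrite invr_ge0 ltW.
    exact: coercive_opbound_invmx (quad_ulsubmx hS1).
  exact: opbound_ulsubmx.
- exact: coercive_opbound_invmx (quad_ulsubmx hA).
Qed.

End ConditionalMean.

(** * Adjusted tapering and its bias *)

Section Tapering.
Context {R : realType}.

Lemma idistC p (i j : 'I_p) : idist i j = idist j i.
Proof. by rewrite /idist distnC. Qed.

Lemma taper_sym p k (S : 'M[R]_p) : S^T = S -> (taper k S)^T = taper k S.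
Proof.
move=> Ss; apply/matrixP => i j; rewrite !mxE -[in LHS]Ss mxE.
by rewrite /taper_weight idistC.
Qed.

Lemma taperB p k (S S' : 'M[R]_p) : taper k (S - S') = taper k S - taper k S'.
Proof. by apply/matrixP => i j; rewrite !mxE mulrBr. Qed.

(** Each term satisfies [2 |x_i x_j| <= x_i^2 + x_j^2], and by symmetry row sums obey the same bound
    as column sums. *)
Lemma schur_test p (B : 'M[R]_p) c : B^T = B -> (forall j, \sum_i `|B i j| <= c) ->
  forall x, `|dot x (B *m x)| <= c * dot x x.
Proof.
move=> Bs h x.
have half : \sum_i \sum_j `|B i j| * x j 0 ^+ 2 <= c * dot x x.
  rewrite exchange_big /= dotE mulr_sumr; apply: ler_sum => j _.
  by rewrite -mulr_suml -expr2 ler_wpM2r ?sqr_ge0.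
have half' : \sum_i \sum_j `|B i j| * x i 0 ^+ 2 <= c * dot x x.
  rewrite exchange_big; apply: le_trans half; apply: ler_sum => j _.
  by apply: ler_sum => i _; rewrite -{1}Bs mxE.
have -> : c * dot x x = 2^-1 * (c * dot x x + c * dot x x) by field.
apply: (le_trans _ (ler_wpM2l _ (lerD half half'))); last by rewrite invr_ge0.
rewrite dotE -big_split /= mulr_sumr; apply: le_trans (ler_norm_sum _ _ _) _.
apply: ler_sum => i _; rewrite mxE -big_split /= !mulr_sumr.
apply: le_trans (ler_norm_sum _ _ _) _; apply: ler_sum => j _.
rewrite !normrM -mulrDr mulrCA [leRHS]mulrCA ler_wpM2l //.
have := sqr_ge0 (`|x i 0| - `|x j 0|); rewrite sqrrB !real_normK ?num_real //; lra.
Qed.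

Lemma taper_weight_le1 p k (i j : 'I_p) : `|taper_weight k i j - 1 : R| <= 1.
Proof.
rewrite /taper_weight; case: ifP => [_|]; first by rewrite subrr normr0 ler01.
move=> /negbT; rewrite -ltNge => h1.
case: ifP => h2; last by rewrite sub0r normrN1.
have k0 : 0 < k%:R / 2 :> R by rewrite divr_gt0 // (le_lt_trans _ h2).
have a1 : 1 < (idist i j)%:R / (k%:R / 2) :> R by rewrite ltr_pdivlMr // mul1r.
have a2 : (idist i j)%:R / (k%:R / 2) < 2 :> R.
  by rewrite ltr_pdivrMr // mulrC divfK.
by rewrite ler_norml; apply/andP; split; lra.
Qed.

Lemma taper_weight_near p k (i j : 'I_p) : (idist i j < k./2)%N ->
  taper_weight k i j = 1 :> R.
Proof.
move=> h; rewrite /taper_weight ifT // ler_pdivlMr // -natrM ler_nat.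
have := odd_double_half k; lia.
Qed.

(** Tapering leaves the entries at distance less than [k./2] unchanged and moves any other entry by
    at most its absolute value. The column sums of the bias are thus tails controlled by the
    bandable class, and the Schur test applies. *)
Lemma taper_bias p k alpha M M0 M1 (S : 'M[R]_p) : (0 < k./2)%N ->
  bandable alpha M M0 M1 S ->
  forall x, `|dot x ((taper k S - S) *m x)| <= M * (k./2)%:R `^ (- alpha) * dot x x.
Proof.
move=> k0 [[Ss _] hb _ _]; apply: schur_test.
  by rewrite linearB /= taper_sym // Ss.
move=> j; apply: le_trans (hb _ k0).
apply: le_trans (le_bigmax _ _ j); rewrite /= [leRHS]big_mkcond /=; apply: ler_sum => i _.
rewrite !mxE -{2}[S i j]mul1r -mulrBl normrM; case: ifPn => [_|].
  by rewrite -[leRHS]mul1r ler_wpM2r // taper_weight_le1.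
by rewrite -ltnNge => /(taper_weight_near) ->; rewrite subrr normr0 mul0r.
Qed.

(** Since [lambda_min T >= l - delta], the added multiple [mu] of the identity is at most
    [eps + delta], so the adjusted matrix is within [2 * delta + eps] of [Sigma]. Its coercivity
    constant [lT + mu] is at least both [eps] and [l - delta]. *)
Lemma adjusted_taper_loss p0 q k eps delta l M0 (S Sigma : 'M[R]_(p0 + q)) :
  (0 < p0 + q)%N -> S^T = S -> Sigma^T = Sigma -> 0 < eps -> 0 <= delta ->
  0 < l -> 0 <= M0 -> opbound Sigma M0 ->
  (forall x, l * dot x x <= dot x (Sigma *m x)) ->
  (forall x, `|dot x ((taper k S - Sigma) *m x)| <= delta * dot x x) ->
  spectral_norm (psi Sigma - psi (adjusted_taper k eps S)) <=
    (1 + M0 / l) * (2 * delta + eps) / Num.max eps (l - delta).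
Proof.
move=> p00 Ss Sigs e0 d0 l0 M00 hS hl hd.
have Ts : (taper k S)^T = taper k S by rewrite taper_sym.
set T := taper k S; set lT := lambda_min T.
have TE x : dot x (T *m x) = dot x (Sigma *m x) + dot x ((T - Sigma) *m x).
  by rewrite mulmxBl dotDr dotNr addrC subrK.
have lTge : l - delta <= lT.
  apply: le_lambda_min => // x; have := hl x; have := hd x.
  rewrite -/T TE ler_norml mulrBl => /andP [h1 h2] h3; lra.
set mu := Num.max (eps - lT) 0.
have mu0 : 0 <= mu by rewrite le_max lexx orbT.
have mule : mu <= eps + delta by rewrite ge_max; apply/andP; split; lra.
have m0 : 0 < Num.max eps (l - delta) by rewrite lt_max e0.
have lTmu : Num.max eps (l - delta) <= lT + mu.
  rewrite ge_max; apply/andP; split; last by lra.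
  by rewrite -lerBlDl le_max lexx.
apply: spectral_norm_le.
  apply: divr_ge0 (ltW m0); apply: mulr_ge0; last by rewrite addr_ge0 ?mulr_ge0 // ltW.
  by rewrite addr_ge0 // divr_ge0 // ltW.
have AB : adjusted_taper k eps S - Sigma = (T - Sigma) + mu *: 1%:M.
  by rewrite /adjusted_taper -/T -/lT -/mu addrAC.
apply: psi_lipschitz => //; first by rewrite addr_ge0 ?(ltW e0) ?mulr_ge0.
- rewrite AB => x.
  have -> : 2 * delta + eps = delta + (delta + eps) by ring.
  apply: opboundD; first by apply: sym_quad_opbound; rewrite // linearB /= Ts Sigs.
  move=> y; rewrite scalemx1 mul_scalar_mx norm2Z ger0_norm // ler_wpM2r ?norm2_ge0 //.
  lra.
- move=> x; rewrite /adjusted_taper -/T -/lT -/mu scalemx1 mulmxDl mul_scalar_mx.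
  rewrite dotDr dotZr; apply: le_trans (ler_wpM2r (dot_ge0 _) lTmu) _.
  by rewrite mulrDl lerD2r lambda_min_quad.
Qed.

End Tapering.

(** * Finite nets and windows *)

Section Nets.
Context {R : realType}.

Lemma sum_half_pow_le2 m : \sum_(v < m) (2^-1 : R) ^+ v <= 2.
Proof.
have -> : \sum_(v < m) (2^-1 : R) ^+ v = 2 - 2 * 2^-1 ^+ m.
  elim: m => [|m IH]; first by rewrite big_ord0 expr0 mulr1 subrr.
  by rewrite big_ord_recr /= IH exprS; field.
by rewrite gerBl mulr_ge0 // exprn_ge0.
Qed.

Definition supported_on p (W : {set 'I_p}) (x : 'cV[R]_p) : Prop :=
  forall i, i \notin W -> x i 0 = 0.

(* The points of the lattice (4 sqrt k)^-1 Z^W in the unit ball; z i encodes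
   an integer by its sign and absolute value.  Their number is at most the sum
   of 2^(16 k - |z|^2) over all z, which factorizes over the coordinates. *)
Lemma lattice_net p k (W : {set 'I_p}) : (0 < k)%N -> (#|W| <= k)%N ->
  exists s : seq 'cV[R]_p,
  [/\ (size s <= (2 ^ 18) ^ k)%N,
      forall y, y \in s -> dot y y <= 1 &
      forall x, supported_on W x -> dot x x <= 1 ->
        exists y, [/\ y \in s, supported_on W y & dot (x - y) (x - y) <= 4^-1 ^+ 2]].
Proof.
move=> k0 Wk; pose c : R := 4 * Num.sqrt k%:R.
have kR : 0 < k%:R :> R by rewrite ltr0n.
have c0 : 0 < c by rewrite mulr_gt0 // sqrtr_gt0.
have c2 : c ^+ 2 = 16 * k%:R by rewrite exprMn sqr_sqrtr ?ler0n // -natrX.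
have c_neq0 : c != 0 by rewrite gt_eqF.
pose J := (bool * 'I_(4 * k).+1)%type.
pose J0 : J := (false, ord0).
pose Z := [set z : {ffun 'I_p -> J} |
  (\sum_i (z i).2 ^ 2 <= 16 * k)%N && [forall i, (i \in W) || (z i == J0)]].
pose vec (z : {ffun 'I_p -> J}) : 'cV[R]_p := \col_i ((-1) ^+ (z i).1 * ((z i).2%:R / c)).
have vec_sq z : dot (vec z) (vec z) = (\sum_i (z i).2 ^ 2)%:R / c ^+ 2.
  rewrite dotE natr_sum mulr_suml; apply: eq_bigr => i _.
  by rewrite mxE mulrACA -expr2 sqrr_sign mul1r -expr2 exprMn exprVn natrX.
exists [seq vec z | z <- enum Z]; split.
- rewrite size_map -cardE.
  (* Outside [W] the weight is the indicator of the code of zero, so those coordinates contribute a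
     factor 1; inside, the two signs give at most 2 + 2. *)
  pose g i (u : J) : R := if i \in W then 2^-1 ^+ u.2 else (u == J0)%:R.
  have g_ge0 i u : 0 <= g i u by rewrite /g; case: ifP => _; rewrite ?exprn_ge0.
  have gsum i : \sum_u g i u <= if i \in W then 4 else 1.
    rewrite /g; case: ifP => _.
      rewrite -(pair_bigA _ (fun _ v => 2^-1 ^+ (v : 'I__))) /= big_bool /=.
      by rewrite (_ : 4 = 2 + 2) ?lerD ?sum_half_pow_le2 // -natrD.
    by rewrite (bigD1 J0) //= big1 ?addr0 // => u /negPf ->.
  suff : #|Z|%:R <= ((2 ^ 18) ^ k)%:R :> R by rewrite ler_nat.
  apply: (@le_trans _ _ (\sum_(z in Z) 2 ^+ (16 * k) * \prod_i g i (z i))).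
    rewrite -sum1_card natr_sum; apply: ler_sum => z; rewrite inE => /andP [z1 /forallP z2].
    (* Because [v <= v ^ 2] for natural numbers, the sum of the absolute values is also at most
       [16 * k], so each net point has weight at least 1. *)
    apply: (@le_trans _ _ (2 ^+ (16 * k) * 2^-1 ^+ (\sum_i (z i).2))).
      have h : (\sum_i (z i).2 <= 16 * k)%N.
        apply: leq_trans z1; apply: leq_sum => i _; rewrite -mulnn.
        by case: (nat_of_ord _) => // n; apply: leq_pmull.
      rewrite -(subnK h) exprD -mulrA -exprMn divff // expr1n mulr1.
      by rewrite exprn_ege1 // ler1n.
    rewrite ler_wpM2l ?exprn_ge0 // expr_sum; apply: ler_prod => i _.
    rewrite exprn_ge0 //= /g; case: ifP (z2 i) => //= _ /eqP ->.
    by rewrite eqxx expr0.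
  rewrite -mulr_sumr; apply: (@le_trans _ _ (2 ^+ (16 * k) * 4 ^+ #|W|)).
    rewrite ler_wpM2l ?exprn_ge0 //.
    apply: (@le_trans _ _ (\sum_(z : {ffun 'I_p -> J}) \prod_i g i (z i))).
      rewrite [leRHS](bigID (mem Z)) /= lerDl sumr_ge0 // => z _.
      by apply: prodr_ge0.
    rewrite -bigA_distr_bigA /= -[4 ^+ _]prodr_const [leRHS]big_mkcond /=.
    by apply: ler_prod => i _; rewrite gsum sumr_ge0.
  rewrite natrX natrX (_ : 18 = 16 + 2)%N // exprD exprMn -exprM ler_wpM2l ?exprn_ge0 //.
  have -> : (2 ^+ 2 : R) = 4 by rewrite -natrX.
  by apply: ler_weXn2l => //; rewrite ler1n.
- move=> y /mapP [z]; rewrite mem_enum inE => /andP [z1 _] ->.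
  by rewrite vec_sq c2 ler_pdivrMr ?mulr_gt0 // mul1r -natrM ler_nat.
- move=> x xW x1.
  (* Rounding toward zero keeps every coordinate below that of [x] in absolute value, so the lattice
     point stays in the unit ball. *)
  pose v i := Num.trunc (c * `|x i 0|).
  have v_itv i : (v i)%:R <= c * `|x i 0| < (v i).+1%:R.
    by apply: truncn_itv; rewrite mulr_ge0 // ltW.
  have xi1 i : x i 0 ^+ 2 <= 1.
    apply: le_trans x1; rewrite dotE (bigD1 i) //= -expr2 lerDl sumr_ge0 // => j _.
    by rewrite -expr2 sqr_ge0.
  have ck : c <= (4 * k)%:R.
    rewrite natrM ler_wpM2l // -ler_sqr ?nnegrE ?sqrtr_ge0 ?ler0n // sqr_sqrtr ?ler0n //.
    by rewrite -natrX ler_nat -mulnn leq_pmull.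
  have v_small i : (v i < (4 * k).+1)%N.
    rewrite ltnS -(ler_nat R); case/andP: (v_itv i) => h _; apply: le_trans h _.
    apply: le_trans ck; rewrite ger_pMr // -(@expr_le1 _ 2) //.
    by rewrite real_normK ?num_real.
  pose z : {ffun 'I_p -> J} := [ffun i => (x i 0 < 0, Ordinal (v_small i))].
  have zx i : `|vec z i 0| <= `|x i 0| /\ (vec z - x) i 0 ^+ 2 <= c^-1 ^+ 2.
    have : x i 0 = (-1) ^+ (x i 0 < 0)%R * `|x i 0| by rewrite -numEsign.
    rewrite !mxE !ffunE /=; case/andP: (v_itv i); set s := (-1) ^+ _.
    rewrite -natr1 => h1 h2 xE.
    rewrite normrM normr_sign mul1r ger0_norm ?divr_ge0 ?ler0n ?(ltW c0) //.
    split; first by rewrite ler_pdivrMr // mulrC.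
    rewrite [X in _ - X]xE -mulrBr exprMn sqrr_sign mul1r -sqrrN opprB.
    rewrite ler_sqr ?nnegrE ?invr_ge0 ?(ltW c0) //; last first.
      by rewrite subr_ge0 ler_pdivrMr // mulrC.
    by rewrite lerBlDl -[X in _ + X]mul1r -mulrDl ler_pdivlMr // mulrC; apply: ltW.
  have zW i : i \notin W -> z i = J0.
    move=> /xW xi; rewrite ffunE xi ltxx; congr pair; apply: val_inj => /=.
    by apply/eqP; rewrite /v xi normr0 mulr0 trunc0.
  exists (vec z); split.
  - apply/mapP; exists z => //; rewrite mem_enum inE; apply/andP; split.
      have : dot (vec z) (vec z) <= 1.
        apply: le_trans x1; rewrite !dotE; apply: ler_sum => i _.
        rewrite -!expr2 -real_normK ?num_real // -[leRHS]real_normK ?num_real //.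
        by rewrite ler_sqr ?nnegrE //; case: (zx i).
      by rewrite vec_sq c2 ler_pdivrMr ?mulr_gt0 // mul1r -natrM ler_nat.
    by apply/forallP => i; have [//|/zW ->] := boolP (i \in W); rewrite eqxx.
  - by move=> i /zW zi; rewrite mxE zi /= expr0 mul0r mulr0.
  - rewrite -opprB dotNl dotNr opprK dotE.
    (* At most [k] coordinates, each with error at most [1 / c], give a squared distance of at most
       [k / (16 k)]. *)
    apply: (@le_trans _ _ (\sum_(i in W) c^-1 ^+ 2)).
      rewrite [leRHS]big_mkcond; apply: ler_sum => i _; rewrite -expr2.
      case: ifPn => [_|iW]; first by case: (zx i).
      by rewrite !mxE (zW i iW) (xW i iW) /= expr0 mul0r mulr0 subr0 expr0n.
    rewrite sumr_const -[leLHS]mulr_natl [c^-1 ^+ 2]exprVn c2 ler_pdivrMr ?mulr_gt0 //.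
    rewrite (_ : 4^-1 ^+ 2 * (16 * k%:R) = k%:R) ?ler_nat //.
    by field.
Qed.
End Nets.

(** * Windows, and a single net controlling the tapered form *)

Section TaperingNet.
Context {R : realType}.

(** The projection onto the coordinates in [W]. A block of [E] becomes [mask W *m E *m mask W], so
    blocks on different windows have the same type and can be summed. *)
Definition mask p (W : {set 'I_p}) : 'M[R]_p := diag_mx (\row_i (i \in W)%:R).

Lemma mask_mulE p (W : {set 'I_p}) (x : 'cV[R]_p) i :
  (mask W *m x) i 0 = (i \in W)%:R * x i 0.
Proof. by rewrite mul_diag_mx !mxE. Qed.

Lemma mask_supported p (W : {set 'I_p}) (x : 'cV[R]_p) : supported_on W (mask W *m x).
Proof. by move=> i /negPf iW; rewrite mask_mulE iW mul0r. Qed.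

Lemma mask_id p (W : {set 'I_p}) (x : 'cV[R]_p) :
  supported_on W x -> mask W *m x = x.
Proof.
move=> xW; apply/colP => i; rewrite mask_mulE.
by have [_|/xW ->] := boolP (i \in W); rewrite ?mul1r ?mulr0.
Qed.

Lemma dot_mask p (W : {set 'I_p}) (x : 'cV[R]_p) :
  dot (mask W *m x) (mask W *m x) = \sum_i (i \in W)%:R * x i 0 ^+ 2.
Proof.
rewrite dotE; apply: eq_bigr => i _; rewrite mask_mulE.
by case: (i \in W); rewrite /= ?mul0r // !mul1r expr2.
Qed.

Lemma dot_mask_le p (W : {set 'I_p}) (x : 'cV[R]_p) :
  dot (mask W *m x) (mask W *m x) <= dot x x.
Proof.
rewrite dot_mask dotE; apply: ler_sum => i _; rewrite -expr2.
by case: (i \in W); rewrite ?mul1r // mul0r sqr_ge0.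
Qed.

Lemma quad_masked p (W : {set 'I_p}) (E : 'M[R]_p) (x y : 'cV[R]_p) :
  dot x ((mask W *m E *m mask W) *m y) = dot (mask W *m x) (E *m (mask W *m y)).
Proof. by rewrite dot_mull /mask tr_diag_mx !mulmxA. Qed.

(** If [y] approximates the masked vector [z] within 1/4, the two quadratic forms differ by
    [(z - y) . B (z + y)], at most [1/4 * 2] times the norm of [B]. Half of the supremum is
    absorbed, which leaves the factor 2. *)
Lemma net_quad p (W : {set 'I_p}) (s : seq 'cV[R]_p) (E : 'M[R]_p) (Q : R) :
  E^T = E -> 0 <= Q ->
  (forall x, supported_on W x -> dot x x <= 1 ->
     exists y, [/\ y \in s, supported_on W y & dot (x - y) (x - y) <= 4^-1 ^+ 2]) ->
  (forall y, y \in s -> dot y y <= 1) ->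
  (forall y, y \in s -> `|dot y (E *m y)| <= Q) ->
  forall x, `|dot (mask W *m x) (E *m (mask W *m x))| <=
    2 * Q * dot (mask W *m x) (mask W *m x).
Proof.
move=> Es Q0 net net1 hQ.
pose B := mask W *m E *m mask W.
have Bs : B^T = B by rewrite !trmx_mul Es /mask tr_diag_mx mulmxA.
pose V := [set `|dot x (B *m x)| | x in [set x | norm2 x <= 1]].
have V0 : V !=set0 by exists `|dot 0 (B *m 0)|; exists 0; rewrite //= norm2E dot0l sqrtr0.
have Vs : has_sup V.
  split=> //; have [K K0 hK] := opbound_exists B; exists K => _ [x /= x1 <-].
  apply: le_trans (dot_le _ _) _; rewrite -[leRHS]mul1r ler_pM ?norm2_ge0 //.
  by apply: le_trans (hK x) _; rewrite ger_pMr.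
have Vub x : norm2 x <= 1 -> `|dot x (B *m x)| <= sup V.
  by move=> x1; apply: (ub_le_sup Vs.2); exists x.
have S0 : 0 <= sup V.
  by apply: le_trans (Vub 0 _); rewrite // norm2E dot0l sqrtr0.
have Bop : opbound B (sup V).
  apply: sym_quad_opbound => // x; have [->|x0] := eqVneq x 0.
    by rewrite !dot0l mulr0 normr0.
  have n0 : norm2 x != 0 by rewrite norm2_eq0.
  have := Vub ((norm2 x)^-1 *: x).
  rewrite norm2Z ger0_norm ?invr_ge0 ?norm2_ge0 // mulVf // => /(_ (lexx _)).
  rewrite -scalemxAr dotZl dotZr mulrA -expr2 exprVn sqr_norm2 normrM.
  rewrite ger0_norm ?invr_ge0 ?dot_ge0 // mulrC ler_pdivrMr // dot_gt0 //.
have SQ : sup V <= Q + sup V / 2.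
  apply: ge_sup => // _ [x /= x1 <-].
  have mx1 : dot (mask W *m x) (mask W *m x) <= 1.
    by apply: le_trans (dot_mask_le _ _) _; rewrite -[1](expr1n _ 2) -le_norm2.
  have [y [ys yW xy]] := net _ (@mask_supported _ W x) mx1.
  have qx : dot x (B *m x) = dot (mask W *m x) (B *m (mask W *m x)).
    by rewrite !quad_masked (mask_id (@mask_supported _ W x)).
  have -> : dot x (B *m x) = dot y (B *m y)
      + dot (mask W *m x - y) (B *m (mask W *m x + y)).
    rewrite qx mulmxDr !(dotDl, dotDr) !dotNl.
    have -> : dot y (B *m (mask W *m x)) = dot (mask W *m x) (B *m y).
      by rewrite dotC dot_mull Bs.
    ring.
  apply: le_trans (ler_normD _ _) _; apply: lerD.
    by rewrite quad_masked (mask_id yW) hQ.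
  apply: le_trans (dot_le _ _) _.
  have n1 : norm2 (mask W *m x - y) <= 4^-1 by rewrite le_norm2 // invr_ge0.
  have n2 : norm2 (mask W *m x + y) <= 2.
    apply: le_trans (norm2D _ _) _; rewrite (_ : 2 = 1 + 1) // lerD // le_norm2 // expr1n //.
    exact: net1.
  apply: (@le_trans _ _ (4^-1 * (sup V * 2))); last by lra.
  rewrite ler_pM ?norm2_ge0 // (le_trans (Bop _)) // ler_wpM2l //.
move=> x; rewrite -[in X in `|X|](mask_id (@mask_supported _ W x)) -quad_masked.
have := dot_ge0 (mask W *m x); set z := mask W *m x => z0.
apply: le_trans (dot_le _ _) _; rewrite -sqr_norm2 expr2 mulrA mulrC.
rewrite ler_wpM2r ?norm2_ge0 // (le_trans (Bop _)) // ler_wpM2r ?norm2_ge0 //; lra.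
Qed.

Definition window p (c k l : nat) : {set 'I_p} :=
  [set i : 'I_p | (c * i <= l < c * i + k)%N].

Lemma card_window p c k l : (0 < c)%N -> (#|window p c k l| <= k)%N.
Proof.
move=> c0; case: k => [|k].
  rewrite leqn0 cards_eq0; apply/eqP/finset.setP => i; rewrite !inE addn0.
  by rewrite ltnNge andbN.
pose f (i : 'I_p) : 'I_k.+1 := inord (l - c * i).
have <- : #|f @: window p c k.+1 l| = #|window p c k.+1 l|; last first.
  by rewrite (leq_trans (max_card _)) ?card_ord.
apply: card_in_imset => i j; rewrite !inE => hi hj /(congr1 val) /=; rewrite !inordK; try lia.
by move=> h; apply/val_inj/eqP => /=; rewrite -(eqn_pmul2l c0); lia.
Qed.

Lemma sum_ltn_itv N a b : (\sum_(l < N) (a <= l < b) = minn N b - a)%N.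
Proof.
elim: N => [|N IH]; first by rewrite big_ord0 min0n sub0n.
rewrite big_ord_recr /= IH; lia.
Qed.

(** Both indices lie in window [l] exactly when [l] is in an interval of length [k - c |i - j|]. The
    truncated subtraction gives the positive part, and the range [c * p + k] contains every such
    [l]. *)
Lemma sum_window p c k (i j : 'I_p) :
  (\sum_(l < c * p + k) (i \in window p c k l) * (j \in window p c k l)
    = k - c * idist i j)%N.
Proof.
under eq_bigr => l _.
  rewrite mulnb !inE.
  rewrite (_ : _ && _ = (maxn (c * i) (c * j) <= l < minn (c * i) (c * j) + k)%N).
    over.
  lia.
rewrite sum_ltn_itv /idist.
have hi : (c * i <= c * p)%N by rewrite leq_mul2l (ltnW (ltn_ord i)) orbT.
have hj : (c * j <= c * p)%N by rewrite leq_mul2l (ltnW (ltn_ord j)) orbT.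
have [ij|ji] := leqP i j.
  by rewrite distnEr // mulnBr; have := leq_mul2l c i j; rewrite ij orbT; lia.
rewrite distnEl ?(ltnW ji) // mulnBr; have := leq_mul2l c j i.
by rewrite (ltnW ji) orbT; lia.
Qed.

(* The kernel (k - c |i - j|)_+ is the average of the masks of the windows. *)
Lemma window_kernel p c k (E : 'M[R]_p) :
  \matrix_(i, j) ((k - c * idist i j)%:R * E i j) =
  \sum_(l < c * p + k) mask (window p c k l) *m E *m mask (window p c k l).
Proof.
apply/matrixP => i j; rewrite mxE summxE -sum_window natr_sum mulr_suml.
apply: eq_bigr => l _; rewrite mul_mx_diag mul_diag_mx !mxE natrM.
ring.
Qed.

(** Every index lies in exactly [k] windows, by [sum_window] on the diagonal, so the squared norms
    of the masked vectors add up to [k] times that of [x]. *)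
Lemma window_quad p c k (E : 'M[R]_p) (Q : R) :
  (forall (l : nat) (x : 'cV[R]_p), (l < c * p + k)%N ->
    `|dot (mask (window p c k l) *m x) (E *m (mask (window p c k l) *m x))| <=
    2 * Q * dot (mask (window p c k l) *m x) (mask (window p c k l) *m x)) ->
  forall x, `|dot x ((\matrix_(i, j) ((k - c * idist i j)%:R * E i j)) *m x)|
    <= k%:R * (2 * Q * dot x x).
Proof.
move=> h x; rewrite window_kernel mulmx_suml.
have -> : dot x (\sum_(l < c * p + k) mask (window p c k l) *m E *m mask (window p c k l) *m x)
   = \sum_(l < c * p + k) dot (mask (window p c k l) *m x) (E *m (mask (window p c k l) *m x)).
  under [RHS]eq_bigr do rewrite -quad_masked.
  by rewrite /dot mulmx_sumr summxE.
apply: le_trans (ler_norm_sum _ _ _) _.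
apply: (@le_trans _ _ (\sum_(l < c * p + k) 2 * Q *
    dot (mask (window p c k l) *m x) (mask (window p c k l) *m x))).
  by apply: ler_sum => l _; apply: h.
rewrite -mulr_sumr mulrCA le_eqVlt; apply/orP; left; apply/eqP; congr (_ * _).
under eq_bigr do rewrite dot_mask.
rewrite exchange_big /= dotE mulr_sumr; apply: eq_bigr => i _.
rewrite -mulr_suml -expr2; congr (_ * _).
have := sum_window c k i i; rewrite /idist distnn muln0 subn0.
move=> /(congr1 (fun m : nat => m%:R : R)) <-; rewrite natr_sum; apply: eq_bigr => l _.
by case: (i \in _).
Qed.

(** The trapezoidal weight is a difference of triangles, [(2 (k - h)_+ - (k - 2 h)_+) / k] with
    [h = |i - j|]. *)
Lemma taperE p k (E : 'M[R]_p) : (0 < k)%N ->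
  taper k E = k%:R^-1 *: (2 *: \matrix_(i, j) ((k - 1 * idist i j)%:R * E i j)
     - \matrix_(i, j) ((k - 2 * idist i j)%:R * E i j)).
Proof.
move=> k0; have kR : 0 < k%:R :> R by rewrite ltr0n.
apply/matrixP => i j; rewrite !mxE mulrA -mulrBl mulrA; congr (_ * _).
rewrite /taper_weight mul1n; set h := idist i j.
have -> : (h%:R <= k%:R / 2 :> R) = (2 * h <= k)%N.
  by rewrite ler_pdivlMr // mulrC -natrM ler_nat.
rewrite ltr_nat; case: ifP => h1.
  rewrite !natrB ?natrM; [field; rewrite gt_eqF //|lia|lia].
rewrite (_ : (k - 2 * h)%N = 0%N); last by lia.
case: ifP => h2; last by rewrite (_ : (k - h)%N = 0%N) ?mulr0 ?subrr ?mulr0 //; lia.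
rewrite natrB; [field; rewrite gt_eqF //|lia].
Qed.

Lemma windows_net p c k : (0 < c)%N -> (0 < k)%N ->
  exists s : seq 'cV[R]_p,
  [/\ (size s <= (c * p + k) * (2 ^ 18) ^ k)%N,
      forall y, y \in s -> dot y y <= 1 &
      forall (E : 'M[R]_p) (Q : R), E^T = E -> 0 <= Q ->
        (forall y, y \in s -> `|dot y (E *m y)| <= Q) ->
        forall x, `|dot x ((\matrix_(i, j) ((k - c * idist i j)%:R * E i j)) *m x)|
          <= k%:R * (2 * Q * dot x x)].
Proof.
move=> c0 k0.
have /choice [f hf] (l : nat) := @lattice_net R p k (window p c k l) k0 (card_window _ _ _ c0).
exists (flatten [seq f l | l <- iota 0 (c * p + k)]); split.
- rewrite size_flatten /shape -map_comp sumnE big_map.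
  apply: (@leq_trans (\sum_(l <- iota 0 (c * p + k)) (2 ^ 18) ^ k)).
    by apply: leq_sum => l _; case: (hf l).
  by rewrite big_const_seq count_predT size_iota iter_addn_0 mulnC.
- by move=> y /flatten_mapP [l _]; case: (hf l) => _ + _; apply.
- move=> E Q Es Q0 hQ; apply: window_quad => l x lN.
  case: (hf l) => _ h1 h2; apply: (net_quad Es Q0 h2 h1) => y ys.
  by apply: hQ; apply/flatten_mapP; exists l; rewrite // mem_iota.
Qed.

(** The two kernels enter with coefficients 2 and 1 and each costs [2 * Q], whence [6 * Q]. The nets
    have [p + k] and [2 p + k] windows, at most [5 p] in all; the extra point 0 makes the net
    visibly nonempty, so that a maximum over it exists. *)
Lemma taper_net p k : (0 < k <= p)%N ->
  exists s : seq 'cV[R]_p,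
  [/\ (size s <= 6 * p * (2 ^ 18) ^ k)%N, 0 \in s,
      forall y, y \in s -> dot y y <= 1 &
      forall (E : 'M[R]_p) (Q : R), E^T = E -> 0 <= Q ->
        (forall y, y \in s -> `|dot y (E *m y)| <= Q) ->
        forall x, `|dot x (taper k E *m x)| <= 6 * Q * dot x x].
Proof.
move=> /andP [k0 kp]; have [s1 [n1 u1 h1]] := windows_net p (ltn0Sn 0) k0.
have [s2 [n2 u2 h2]] := windows_net p (ltn0Sn 1) k0.
exists (0 :: s1 ++ s2); split; last 3 first.
- by rewrite inE eqxx.
- move=> y; rewrite inE mem_cat => /orP [/eqP ->|/orP [/u1|/u2] //].
  by rewrite dot0l ler01.
- move=> E Q Es Q0 hQ x.
  have {}h1 : `|dot x ((\matrix_(i, j) ((k - 1 * idist i j)%:R * E i j)) *m x)|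
      <= k%:R * (2 * Q * dot x x).
    by apply: h1 => // y ys; apply: hQ; rewrite inE mem_cat ys orbT.
  have {}h2 : `|dot x ((\matrix_(i, j) ((k - 2 * idist i j)%:R * E i j)) *m x)|
      <= k%:R * (2 * Q * dot x x).
    by apply: h2 => // y ys; apply: hQ; rewrite inE mem_cat ys !orbT.
  have kR : 0 < k%:R :> R by rewrite ltr0n.
  rewrite taperE // -scalemxAl dotZr normrM ger0_norm ?invr_ge0 ?ler0n //.
  rewrite mulrC ler_pdivrMr // mulmxBl dotDr dotNr -scalemxAl dotZr.
  apply: le_trans (ler_normD _ _) _; rewrite normrN normrM ger0_norm //.
  move: h1 h2; set a1 := `|_|; set a2 := `|_|; lra.
- rewrite /= size_cat; have : (0 < (2 ^ 18) ^ k)%N by rewrite expn_gt0.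
  move: n1 n2; set m := ((2 ^ 18) ^ k)%N; nia.
Qed.

End TaperingNet.

(** * Expectations of independent variables *)

Section SimpleApproximation.
Context {R : realType}.

Import HBNNSimple.

(* Unlike in ge0_le_integral, measurability is not needed: the integral of a
   nonnegative function is a supremum over the simple functions below it. *)
Lemma integral_le_dominating d (T : measurableType d) (mu : {measure set T -> \bar R})
    (f g : T -> \bar R) :
  (forall x, 0 <= f x)%E -> (forall x, f x <= g x)%E ->
  (\int[mu]_x f x <= \int[mu]_x g x)%E.
Proof.
move=> f0 fg; have g0 x : (0 <= g x)%E := le_trans (f0 x) (fg x).
rewrite !ge0_integralTE //; apply: ereal_sup_le => _ [h /= hf <-].
by exists h => //= x; exact: le_trans (hf x) (fg x).
Qed.

Lemma integral_sum_indic d (T : measurableType d) (mu : {measure set T -> \bar R})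
    (I : finType) (c : I -> R) (B : I -> set T) :
  (forall i, 0 <= c i) -> (forall i, measurable (B i)) ->
  (\int[mu]_w (\sum_i c i * \1_(B i) w)%:E = \sum_i (c i)%:E * mu (B i))%E.
Proof.
move=> c0 mB; under eq_integral do rewrite -sumEFin.
rewrite ge0_integral_sum //; last 2 first.
- move=> i; apply/measurable_EFinP/measurable_funM => //; exact: measurable_indic.
- by move=> i x _; rewrite lee_fin mulr_ge0.
apply: eq_bigr => i _; under eq_integral do rewrite EFinM.
rewrite ge0_integralZl //; last 2 first.
- apply/measurable_EFinP; exact: measurable_indic.
- by rewrite lee_fin.
by rewrite integral_indic // setIT.
Qed.

Lemma nnsfun_indicators d' (U : measurableType d') (g : {nnsfun U >-> R}) :
  exists (N : nat) (a : 'I_N -> R) (A : 'I_N -> set U),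
  [/\ forall j, 0 <= a j, forall j, measurable (A j) &
      forall t, g t = \sum_j a j * \1_(A j) t].
Proof.
pose s := finmap.enum_fset (fset_set (range g)).
(* The truncation makes every coefficient nonnegative and changes nothing: a negative value would
   have an empty level set. *)
exists (size s), (fun j => Num.max 0 (nth 0 s j)), (fun j => g @^-1` [set nth 0 s j]).
split=> [j|j|t]; first by rewrite le_max lexx.
- exact: measurable_funPTI.
rewrite fimfunE fsbig_finite //= (big_nth 0) big_mkord; apply: eq_bigr => j _.
case: (leP 0 (nth 0 s j)) => // neg; rewrite mul0r indicE memNset ?mulr0 //=.
by move=> gt; have : 0 <= g t by []; rewrite gt leNgt neg.
Qed.

(** Transfer to a density known only through probabilities of sets: exact for simple functions, then
    passed to the limit by monotone convergence. An upper bound suffices for exponential moments. *)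
Lemma law_integral_le d (T : measurableType d) (P : {measure set T -> \bar R})
    d' (U : measurableType d') (mu : {measure set U -> \bar R}) (xi : T -> U)
    (f F : U -> R) :
  measurable_fun setT xi -> measurable_fun setT f -> measurable_fun setT F ->
  (forall x, 0 <= f x) -> (forall x, 0 <= F x) ->
  (forall A, measurable A -> P (xi @^-1` A) = (\int[mu]_(x in A) (f x)%:E)%E) ->
  (\int[P]_w (F (xi w))%:E <= \int[mu]_x (F x * f x)%:E)%E.
Proof.
move=> mxi mf mF f0 F0 hP.
have mF' : measurable_fun setT (EFin \o F) by apply/measurable_EFinP.
pose g := nnsfun_approx measurableT mF'.
have gcvg t : (EFin \o g^~ t) k @[k --> \oo] --> (F t)%:E.
  by apply: cvg_nnsfun_approx => // x _; rewrite lee_fin.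
have nd t : nondecreasing_seq (g^~ t).
  by move=> a b ab; apply/lefP/nd_nnsfun_approx.
have gcvgR t : g k t @[k --> \oo] --> F t by have /fine_cvgP [] := gcvg t.
have gle k t : g k t <= F t.
  rewrite -(cvg_lim _ (gcvgR t)) //; apply: nondecreasing_cvgn_le => //.
  by apply/cvg_ex; exists (F t).
have step k : (\int[P]_w (g k (xi w))%:E <= \int[mu]_x (F x * f x)%:E)%E.
  have [N [a [A [a0 mA gE]]]] := nnsfun_indicators (g k).
  have mxiA j : measurable (xi @^-1` A j).
    by rewrite -[_ @^-1` _]setTI; apply: mxi.
  under eq_integral do rewrite gE.
  rewrite (integral_sum_indic P a0 (B := fun j => xi @^-1` A j)) //.
  apply: (@le_trans _ _ (\int[mu]_x (g k x * f x)%:E)%E); last first.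
    apply: integral_le_dominating => x; rewrite lee_fin ?mulr_ge0 //.
    by rewrite ler_wpM2r.
  rewrite le_eqVlt; apply/orP; left; apply/eqP.
  under [RHS]eq_integral do rewrite gE mulr_suml -sumEFin.
  rewrite ge0_integral_sum //; last 2 first.
  - move=> j; apply/measurable_EFinP/measurable_funM => //.
    by apply/measurable_funM => //; exact: measurable_indic.
  - by move=> j x _; rewrite lee_fin !mulr_ge0.
  apply: eq_bigr => j _; rewrite hP // integral_mkcond.
  under [RHS]eq_integral do rewrite -mulrA EFinM.
  rewrite ge0_integralZl //; last 3 first.
  - apply/measurable_EFinP/measurable_funM => //; exact: measurable_indic.
  - by move=> x _; rewrite lee_fin mulr_ge0.
  - by rewrite lee_fin.
  congr (_ * _)%E; apply: eq_integral => x _.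
  by rewrite patchE indicE; case: ifP => _; rewrite ?mul1r ?mul0r.
have lim w : limn (fun k => (g k (xi w))%:E) = (F (xi w))%:E.
  by apply/cvg_lim => //; exact: gcvg.
under eq_integral do rewrite -lim.
rewrite monotone_convergence //; last 3 first.
- by move=> k; apply/measurable_EFinP/measurableT_comp.
- by move=> k w _; rewrite lee_fin.
- by move=> w _ a b ab; rewrite lee_fin nd.
apply: lime_le; last by near=> k; exact: step.
apply: ereal_nondecreasing_is_cvgn => a b ab.
by apply: integral_le_dominating => w; rewrite lee_fin ?nd.
Unshelve. all: by end_near.
Qed.

End SimpleApproximation.

(** * Products of functions of independent variables *)

Section Independence.
Context {R : realType} {d : measure_display} {T : measurableType d}.
Variable P : probability T R.

Import HBNNSimple.

Lemma prod_indic (I : finType) (A : I -> set T) (w : T) :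
  \prod_i (\1_(A i) w : R) = \1_[set w | forall i, A i w] w.
Proof.
rewrite [RHS]indicE; case: (pselect (forall i, A i w)) => h.
  by rewrite mem_set // big1 // => i _; rewrite indicE mem_set.
rewrite memNset //; have [i /= Ai] : exists i, ~ A i w by apply/existsNP.
by rewrite (bigD1 i) //= indicE memNset // mul0r.
Qed.

(** Independence is a statement on events, so it is applied to simple functions below [F] first;
    monotone convergence concludes. *)
Lemma independent_prod_le d' (U : measurableType d') n (Z : 'I_n -> {RV P >-> U})
    (F : U -> R) (m : R) :
  (forall A : 'I_n -> set U, (forall i, measurable (A i)) ->
    P [set w | forall i, A i (Z i w)] = (\prod_i P (Z i @^-1` A i))%E) ->
  measurable_fun setT F -> (forall t, 0 <= F t) ->
  (forall i, \int[P]_w (F (Z i w))%:E <= m%:E)%E ->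
  (\int[P]_w (\prod_i F (Z i w))%:E <= (m ^+ n)%:E)%E.
Proof.
move=> ind mF F0 hm.
have mF' : measurable_fun setT (EFin \o F) by apply/measurable_EFinP.
pose g := nnsfun_approx measurableT mF'.
have gcvg t : g k t @[k --> \oo] --> F t.
  have : (EFin \o g^~ t) k @[k --> \oo] --> (F t)%:E.
    by apply: cvg_nnsfun_approx => // x _; rewrite lee_fin.
  by move=> /fine_cvgP [].
have nd t : nondecreasing_seq (g^~ t).
  by move=> a b ab; apply/lefP/nd_nnsfun_approx.
have gle k t : g k t <= F t.
  rewrite -(cvg_lim _ (gcvg t)) //; apply: nondecreasing_cvgn_le => //.
  by apply/cvg_ex; exists (F t).
have mgZ k i : measurable_fun setT (fun w => g k (Z i w)).
  exact: measurableT_comp.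
have step k : (\int[P]_w (\prod_i g k (Z i w))%:E <= (m ^+ n)%:E)%E.
  have [N [a [A [a0 mA gE]]]] := nnsfun_indicators (g k).
  have mZ i j : measurable (Z i @^-1` A j) by rewrite -[_ @^-1` _]setTI; exact: measurable_funP.
  pose q i j : R := fine (P (Z i @^-1` A j)).
  have qE i j : P (Z i @^-1` A j) = (q i j)%:E by rewrite fineK // fin_num_measure.
  have hq i : \sum_j a j * q i j <= m.
    rewrite -lee_fin; apply: le_trans (hm i).
    have -> : (\sum_j a j * q i j)%:E = (\int[P]_w (g k (Z i w))%:E)%E.
      under eq_integral do rewrite gE.
      rewrite (integral_sum_indic P a0 (B := fun j => Z i @^-1` A j)) // -sumEFin.
      by apply: eq_bigr => j _; rewrite /= qE EFinM.
    by apply: integral_le_dominating => w; rewrite lee_fin // fun_ge0.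
  (* The product of sums is expanded over all choices [f] of one level set per variable; each term
     is the indicator of an intersection, whose probability factorizes. *)
  have E w : \prod_i g k (Z i w) =
      \sum_(f : {ffun 'I_n -> 'I_N}) (\prod_i a (f i)) *
        \1_[set w | forall i, A (f i) (Z i w)] w.
    under eq_bigr do rewrite gE.
    rewrite bigA_distr_bigA /=; apply: eq_bigr => f _.
    by rewrite big_split /= -(prod_indic (fun i => Z i @^-1` A (f i))).
  under eq_integral do rewrite E.
  rewrite integral_sum_indic; last 2 first.
  - by move=> f; apply: prodr_ge0.
  - move=> f; rewrite (_ : [set w | _] = \bigcap_(i in [set: 'I_n]) (Z i @^-1` A (f i))).
      by apply: fin_bigcap_measurable.
    by apply/seteqP; split=> [w h i _|w h i]; apply: h.
  have -> : (\sum_(f : {ffun 'I_n -> 'I_N}) (\prod_i a (f i))%:E *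
      P [set w | forall i, A (f i) (Z i w)])%E = (\prod_i \sum_j a j * q i j)%:E.
    rewrite bigA_distr_bigA /= -sumEFin; apply: eq_bigr => f _.
    rewrite (ind (fun i => A (f i))) // big_split /= EFinM -[in RHS]prodEFin; congr (_ * _)%E.
      by rewrite prodEFin.
    by rewrite -prodEFin; apply: eq_bigr => i _; rewrite qE.
  rewrite lee_fin -[n in m ^+ n]card_ord -prodr_const.
  apply: ler_prod => i _; rewrite hq sumr_ge0 // => j _.
  by rewrite mulr_ge0 // /q fine_ge0.
have lim w : limn (fun k => (\prod_i g k (Z i w))%:E) = (\prod_i F (Z i w))%:E.
  apply/cvg_lim => //; apply: cvg_EFin; first by near=> k.
  rewrite /comp /=; elim: (index_enum _) => [|i r IH].
    rewrite (_ : (fun k => _) = fun=> 1); first by rewrite big_nil; apply: cvg_cst.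
    by apply/funext => k; rewrite big_nil.
  rewrite (_ : (fun k => _) = fun k => g k (Z i w) * \prod_(i <- r) g k (Z i w)).
    by rewrite big_cons; apply: cvgM (gcvg _) IH.
  by apply/funext => k; rewrite big_cons.
under eq_integral do rewrite -lim.
have mprod k : measurable_fun setT (fun w => (\prod_i g k (Z i w))%:E).
  by apply/measurable_EFinP/measurable_prod => i _.
have ndprod w a b : (a <= b)%N -> \prod_i g a (Z i w) <= \prod_i g b (Z i w).
  by move=> ab; apply: ler_prod => i _; rewrite fun_ge0 /=; apply: nd.
rewrite monotone_convergence //; last 2 first.
- by move=> k w _; rewrite lee_fin prodr_ge0 // => i _; rewrite fun_ge0.
- by move=> w _ a b ab; rewrite lee_fin ndprod.
apply: lime_le; last by near=> k; exact: step.
apply: ereal_nondecreasing_is_cvgn => a b ab.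
apply: integral_le_dominating => w; rewrite lee_fin ?ndprod //.
by rewrite prodr_ge0 // => i _; rewrite fun_ge0.
Unshelve. all: by end_near.
Qed.

End Independence.

(** * Gaussian exponential moments *)

Section GaussianDeviation.
Context {R : realType}.

(* Multiplying the N(0, s^2) density by exp(t x^2) yields a multiple of the
   N(0, s^2 / (1 - 2 t s^2)) density. *)
Lemma normal_pdf_tilt (s t x : R) : 0 < s -> 2 * t * s ^+ 2 < 1 ->
  expR (t * (x ^+ 2 - s ^+ 2)) * normal_pdf 0 s x =
  expR (- (t * s ^+ 2)) / Num.sqrt (1 - 2 * t * s ^+ 2) *
    normal_pdf 0 (s / Num.sqrt (1 - 2 * t * s ^+ 2)) x.
Proof.
move=> s0 ts; have u0 : 0 < 1 - 2 * t * s ^+ 2 by rewrite subr_gt0.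
set u := 1 - 2 * t * s ^+ 2; have ru0 : 0 < Num.sqrt u by rewrite sqrtr_gt0.
have s'0 : 0 < s / Num.sqrt u by rewrite divr_gt0.
rewrite !normal_pdfE ?gt_eqF // /normal_peak /normal_fun.
have s'2 : (s / Num.sqrt u) ^+ 2 = s ^+ 2 / u.
  by rewrite exprMn exprVn sqr_sqrtr // ltW.
rewrite s'2.
have -> : Num.sqrt (s ^+ 2 / u * pi *+ 2) = Num.sqrt (s ^+ 2 * pi *+ 2) / Num.sqrt u.
  rewrite -sqrtrV ?(ltW u0) // -sqrtrM ?mulrn_wge0 ?mulr_ge0 ?(ltW s0) ?pi_ge0 //.
  by rewrite [in RHS]mulrnAl [in RHS]mulrAC.
have -> (a b c v : R) : 0 < v -> a / v * ((b / v)^-1 * c) = b^-1 * (a * c) => //.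
  by move=> v0; rewrite invf_div -!mulrA mulKf ?gt_eqF // mulrCA.
rewrite mulrCA -!expRD; congr (_ * expR _).
rewrite subr0 -[s ^+ 2 *+ 2]mulr_natr -[s ^+ 2 / u *+ 2]mulr_natr /u; field.
by rewrite !gt_eqF // mulrC.
Qed.

(** The tilted density integrates to 1, so with [z = t * s ^+ 2] the claim becomes
    [exp(-z) / sqrt(1 - 2 z) <= exp(4 z^2)] for [|z| <= 1/4]. *)
Lemma gaussian_exp_sqr_le d (T : measurableType d) (P : probability T R)
    (xi : T -> R) (s t : R) : 0 < s -> `|t| * s ^+ 2 <= 4^-1 ->
  measurable_fun setT xi ->
  (forall A, measurable A -> P (xi @^-1` A) = normal_prob 0 s A) ->
  (\int[P]_w (expR (t * (xi w ^+ 2 - s ^+ 2)))%:E <= (expR (4 * (t * s ^+ 2) ^+ 2))%:E)%E.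
Proof.
move=> s0 ht mxi hxi.
have s20 : 0 < s ^+ 2 by rewrite exprn_gt0.
have htR : t * s ^+ 2 <= 4^-1.
  by apply: le_trans ht; rewrite ler_wpM2r ?ler_norm // ltW.
have htL : - 4^-1 <= t * s ^+ 2.
  rewrite lerNl; apply: le_trans ht; rewrite -mulNr ler_wpM2r ?(ltW s20) //.
  by rewrite -normrN ler_norm.
have u0 : 2 * t * s ^+ 2 < 1 by lra.
have mF : measurable_fun setT (fun x : R => expR (t * (x ^+ 2 - s ^+ 2))).
  apply: measurableT_comp => //; apply: measurable_funM => //.
  by apply: measurable_funB => //; apply: measurable_funX.
have := @law_integral_le R _ _ P _ _ lebesgue_measure xi _ _ mxi
  (measurable_normal_pdf 0 s) mF (normal_pdf_ge0 0 s) (fun x => expR_ge0 _) hxi.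
move=> /le_trans; apply.
under eq_integral do rewrite (normal_pdf_tilt _ s0 u0) EFinM.
rewrite ge0_integralZl //; last 2 first.
- by apply/measurable_EFinP; exact: measurable_normal_pdf.
- by move=> x _; rewrite lee_fin normal_pdf_ge0.
rewrite integral_normal_pdf mule1 lee_fin.
have v0 : 0 < 1 - 2 * t * s ^+ 2 by lra.
rewrite ler_pdivrMr ?sqrtr_gt0 //; set z := t * s ^+ 2.
have -> : 2 * t * s ^+ 2 = 2 * z by rewrite /z mulrA.
have {htR} zR : z <= 4^-1 by []; have {htL} zL : - 4^-1 <= z by []; clearbody z.
rewrite -ler_sqr ?nnegrE ?mulr_ge0 ?expR_ge0 ?sqrtr_ge0 //.
rewrite exprMn sqr_sqrtr; last by lra.
rewrite -!expRM_natl -[expR (2 * - z)]mulr1.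
have -> : expR (2 * (4 * z ^+ 2)) = expR (2 * - z) * expR (2 * z + 8 * z ^+ 2).
  by rewrite -expRD; congr expR; ring.
rewrite -mulrA ler_wpM2l ?expR_ge0 //.
(* After squaring it remains to bound [(1 - 2 z) exp(2 z + 8 z^2)] below by 1; with [exp u >= 1 + u]
   this follows from [1 + 4 z^2 (1 - 4 z) >= 1]. *)
apply: (@le_trans _ _ ((1 + (2 * z + 8 * z ^+ 2)) * (1 - 2 * z))); last first.
  by rewrite ler_wpM2r ?expR_ge1Dx //; lra.
by nra.
Qed.

End GaussianDeviation.

(** * Exponential moments of quadratic forms of the sample covariance *)

Section SampleCovariance.
Context {R : realType} {d : measure_display} {T : measurableType d}.
Variable P : probability T R.

Lemma sample_cov_sym n p (Z : 'I_n -> {RV P >-> p.-tuple R}) w :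
  (sample_cov Z w)^T = sample_cov Z w.
Proof.
rewrite /sample_cov linearZ /= linear_sum /=; congr (_ *: _).
by apply: eq_bigr => i _; rewrite trmx_mul trmxK.
Qed.

Lemma sample_cov_quad n p (Z : 'I_n -> {RV P >-> p.-tuple R}) w (y : 'cV[R]_p) :
  dot y (sample_cov Z w *m y) = n%:R^-1 * \sum_i dot y (tuple_col (Z i w)) ^+ 2.
Proof.
rewrite /sample_cov -scalemxAl dotZr; congr (_ * _).
rewrite mulmx_suml /dot mulmx_sumr summxE; apply: eq_bigr => i _.
rewrite -mulmxA mulmxA mxE big_ord1 expr2; congr (_ * _).
exact: (dotC (tuple_col (Z i w)) y).
Qed.

Lemma measurable_dot_tuple_col p (y : 'cV[R]_p) :
  measurable_fun setT (fun t : p.-tuple R => dot y (tuple_col t)).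
Proof.
under eq_fun do rewrite dotE.
apply: measurable_sum => i; apply: measurable_funM => //.
under eq_fun do rewrite mxE.
exact: measurable_tnth.
Qed.

Lemma measurable_sample_cov_quad n p (Z : 'I_n -> {RV P >-> p.-tuple R})
    (Sigma : 'M[R]_p) (y : 'cV[R]_p) :
  measurable_fun setT (fun w => dot y ((sample_cov Z w - Sigma) *m y)).
Proof.
under eq_fun do rewrite mulmxBl dotDr dotNr sample_cov_quad.
apply: measurable_funB => //; apply: measurable_funM => //.
apply: measurable_sum => i; apply: measurable_funX.
exact: (measurableT_comp (measurable_dot_tuple_col y)).
Qed.

(** The exponential is a product of [n] factors with parameter [h / n], each bounded by the
    one-dimensional Gaussian estimate; [|h| * M0 <= n / 4] is the range condition of that
    estimate. *)
Lemma sample_cov_mgf n p (Z : 'I_n -> {RV P >-> p.-tuple R}) (Sigma : 'M[R]_p)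
    (M0 h : R) (y : 'cV[R]_p) :
  (0 < n)%N -> mutually_independent Z -> (forall i, mvnormal 0 Sigma (Z i)) ->
  posdef Sigma -> dot y (Sigma *m y) <= M0 -> `|h| * M0 <= n%:R / 4 ->
  (\int[P]_w (expR (h * dot y ((sample_cov Z w - Sigma) *m y)))%:E <=
    (expR (4 * (h * M0) ^+ 2 / n%:R))%:E)%E.
Proof.
move=> n0 ind norm [_ pd] yM0 hM0.
have nR : 0 < n%:R :> R by rewrite ltr0n.
have M00 : 0 <= M0.
  apply: le_trans yM0; have [->|/pd] := eqVneq y 0; first by rewrite dot0l.
  by rewrite -mulmxA; apply: ltW.
(* The zero direction is separate because [mvnormal] speaks of nonzero combinations only. *)
have [y0|y0] := eqVneq y 0.
  rewrite y0; under eq_integral do rewrite dot0l mulr0 expR0.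
  rewrite integral_cst //.
  rewrite mul1e (le_trans (probability_le1 P measurableT)) // lee_fin -[leLHS]expR0 ler_expR.
  by rewrite divr_ge0 ?ler0n // mulr_ge0 ?sqr_ge0.
pose s := Num.sqrt (dot y (Sigma *m y)).
have s20 : 0 < dot y (Sigma *m y) by have := pd _ y0; rewrite -mulmxA.
have s2 : s ^+ 2 = dot y (Sigma *m y) by rewrite sqr_sqrtr // ltW.
have s0 : 0 < s by rewrite sqrtr_gt0.
pose F (t : p.-tuple R) := expR (h / n%:R * (dot y (tuple_col t) ^+ 2 - s ^+ 2)).
have mF : measurable_fun setT F.
  apply: measurableT_comp => //; apply: measurable_funM => //.
  by apply: measurable_funB => //; apply: measurable_funX; exact: measurable_dot_tuple_col.
have E w : expR (h * dot y ((sample_cov Z w - Sigma) *m y)) = \prod_i F (Z i w).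
  rewrite -expR_sum; congr expR.
  rewrite mulmxBl dotDr dotNr sample_cov_quad -s2 -mulr_sumr sumrB sumr_const card_ord.
  by rewrite -[s ^+ 2 *+ n]mulr_natr; field; rewrite gt_eqF.
under eq_integral do rewrite E.
have hn : `|h / n%:R| * s ^+ 2 <= 4^-1.
  rewrite normrM normfV (ger0_norm (ltW nR)) mulrAC ler_pdivrMr // mulrC.
  by rewrite mulrC s2 [leRHS]mulrC (le_trans _ hM0) // ler_wpM2l.
apply: le_trans (@independent_prod_le _ _ _ P _ _ _ Z F
  (expR (4 * (h / n%:R * s ^+ 2) ^+ 2)) _ mF _ _) _.
- move=> A mA; have := ind [set: 'I_n]%SET A mA.
  rewrite (eq_bigl xpredT) => [<-|i]; last by rewrite inE.
  by congr (P _); apply/seteqP; split=> w /= hw i => [_|]; apply: hw; rewrite ?inE.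
- by move=> t; exact: expR_ge0.
- move=> i; apply: (gaussian_exp_sqr_le (xi := fun w => dot y (tuple_col (Z i w)))) => //.
    exact: (measurableT_comp (measurable_dot_tuple_col y)).
  by move=> A mA; have := norm i y y0 A mA; rewrite mulmx0 mxE -mulmxA.
rewrite lee_fin -expRM_natl ler_expR.
have -> : n%:R * (4 * (h / n%:R * s ^+ 2) ^+ 2) = 4 * (h * s ^+ 2) ^+ 2 / n%:R.
  by field; rewrite gt_eqF.
rewrite ler_wpM2r ?invr_ge0 ?ler0n // ler_wpM2l //.
rewrite !exprMn ler_wpM2l ?sqr_ge0 // ler_sqr ?nnegrE ?s2 //; exact: ltW.
Qed.

End SampleCovariance.

(** * The risk *)

Section RiskBound.
Context {R : realType}.

Lemma seq_max_exists (A : eqType) (f : A -> R) (s : seq A) (x : A) : x \in s ->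
  exists2 y, y \in s & forall z, z \in s -> f z <= f y.
Proof.
elim: s x => [//|a s IH] x _; case: s IH => [_|b s IH].
  by exists a; rewrite ?inE // => z; rewrite inE => /eqP ->.
have [y ys hy] := IH b (mem_head _ _); have [ay|/ltW ya] := leP (f a) (f y).
  exists y; first by rewrite inE ys orbT.
  by move=> z; rewrite inE => /orP [/eqP ->|/hy].
exists a; first exact: mem_head.
by move=> z; rewrite inE => /orP [/eqP ->|/hy /le_trans ->].
Qed.

Lemma sqr_le_exp (u : R) : 0 <= u -> u ^+ 2 <= 4 * expR u.
Proof.
move=> u0; have -> : expR u = expR (u / 2) ^+ 2.
  by rewrite -expRM_natl; congr expR; field.
rewrite (_ : 4 = 2 ^+ 2); last by rewrite -natrX.
rewrite -exprMn ler_sqr ?nnegrE ?mulr_ge0 ?expR_ge0 //.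
have := expR_ge1Dx (u / 2); lra.
Qed.

(* Lets exponential moments of Q control both its mean square (r of the order
   of the typical size of Q) and its mean square on the event tau < Q. *)
Lemma sqr_le_tail (h r Q : R) : 0 < h -> 0 <= r -> 0 <= Q ->
  Q ^+ 2 <= 2 * r ^+ 2 + 8 / h ^+ 2 * expR (h * (Q - r)).
Proof.
move=> h0 r0 Q0; have [Qr|rQ] := leP Q r.
  have : Q ^+ 2 <= r ^+ 2 by rewrite ler_sqr.
  have : 0 <= 8 / h ^+ 2 * expR (h * (Q - r)).
    by rewrite mulr_ge0 ?expR_ge0 ?divr_ge0 ?exprn_ge0 // ltW.
  have := sqr_ge0 r; lra.
have hQ : 0 <= h * (Q - r) by rewrite mulr_ge0 ?subr_ge0 ?ltW.
have : (Q - r) ^+ 2 <= 4 / h ^+ 2 * expR (h * (Q - r)).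
  have := sqr_le_exp hQ; rewrite exprMn mulrC -ler_pdivlMr ?exprn_gt0 // => /le_trans; apply.
  by rewrite mulrAC.
have -> : 8 / h ^+ 2 * expR (h * (Q - r)) = 2 * (4 / h ^+ 2 * expR (h * (Q - r))) by ring.
have := sqr_ge0 (Q - 2 * r); move: (4 / _ * _) => E; lra.
Qed.

(** The lower bound [t] on [h] makes the prefactor independent of [h], which will grow with the
    sample size. *)
Lemma sqr_le_tail_above (h t tau Q : R) : 0 < t -> t <= h -> 0 <= tau -> tau < Q ->
  Q ^+ 2 <= (2 * tau ^+ 2 + 8 / t ^+ 2) * expR (h * (Q - tau)).
Proof.
move=> t0 th tau0 tQ; have h0 := lt_le_trans t0 th.
have := sqr_le_tail h0 tau0 (le_trans tau0 (ltW tQ)); move=> /le_trans; apply.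
have e1 : 1 <= expR (h * (Q - tau)).
  by rewrite -[leLHS]expR0 ler_expR mulr_ge0 ?subr_ge0 ?ltW.
rewrite [leRHS]mulrDl lerD //.
  by rewrite ler_peMr // mulr_ge0 ?sqr_ge0.
rewrite ler_wpM2r ?expR_ge0 // ler_wpM2l // lef_pV2 ?posrE ?exprn_gt0 //.
by rewrite ler_sqr ?nnegrE ?(ltW t0) ?(ltW h0).
Qed.

(** If [Q <= M1 / 24] then [b + 6 * Q <= l / 2], so the denominator is at least [M1 / 2]. Otherwise
    the denominator is only known to be at least [eps], which produces the term in
    [Q ^+ 2 / eps ^+ 2]. *)
Lemma loss_scalar_bound (M0 M1 : R) : 0 < M1 -> 0 < M0 ->
  exists Ca Cb : R, [/\ 0 < Ca, 0 < Cb & forall l b Q eps loss : R,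
  M1 <= l -> l <= M0 -> 0 <= b -> b <= l / 4 -> 0 <= Q -> 0 < eps -> 0 <= loss ->
  loss <= (1 + M0 / l) * (2 * (b + 6 * Q) + eps) / Num.max eps (l - (b + 6 * Q)) ->
  loss ^+ 2 <= Ca * (b ^+ 2 + Q ^+ 2 + eps ^+ 2)
    + (if M1 / 24 < Q then Cb * Q ^+ 2 / eps ^+ 2 else 0)].
Proof.
move=> M10 M00; pose kap := 1 + M0 / M1.
have kap_gt0 : 0 < kap by rewrite addr_gt0 // divr_gt0.
have kap2_gt0 : 0 < kap ^+ 2 by rewrite exprn_gt0.
have Ca0 : 0 <= 1728 / M1 ^+ 2 by apply: divr_ge0 (ler0n _ _) (sqr_ge0 _).
have Cb_gt0 : 0 < 2 / (M1 / 24) ^+ 2 by rewrite divr_gt0 // exprn_gt0 // divr_gt0.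
exists (kap ^+ 2 * (1728 / M1 ^+ 2 + 2 / (M1 / 24) ^+ 2)).
exists (8 * kap ^+ 2 * (6 * M0 / M1 + 6) ^+ 2); split.
- exact: mulr_gt0 kap2_gt0 (ltr_wpDl Ca0 Cb_gt0).
- apply: mulr_gt0; first exact: mulr_gt0.
  by rewrite exprn_gt0 // addr_gt0 // divr_gt0 // mulr_gt0.
move=> l b Q eps loss M1l lM0 b0 bl Q0 e0 loss0 hloss.
have l0 : 0 < l := lt_le_trans M10 M1l.
have kap0 := ltW kap_gt0.
have kapl : 1 + M0 / l <= kap.
  by rewrite lerD2l ler_wpM2l ?(ltW M00) // lef_pV2 ?posrE.
set m := Num.max _ _ in hloss.
have num0 : 0 <= 2 * (b + 6 * Q) + eps by lra.
have h1 c : 0 < c -> c <= m -> loss <= kap * ((2 * (b + 6 * Q) + eps) / c).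
  move=> c0 cm; have m0 := lt_le_trans c0 cm.
  apply: le_trans hloss _; rewrite -mulrA ler_pM //.
  - by rewrite addr_ge0 // divr_ge0 // ltW.
  - by rewrite divr_ge0 // ltW.
  - by rewrite ler_wpM2l // lef_pV2 ?posrE.
have sq c x : 0 <= x -> loss <= kap * x -> x ^+ 2 <= c -> loss ^+ 2 <= kap ^+ 2 * c.
  move=> x0 lx xc; apply: (@le_trans _ _ ((kap * x) ^+ 2)).
    by rewrite ler_sqr ?nnegrE // mulr_ge0.
  by rewrite exprMn ler_wpM2l ?sqr_ge0.
have Cb0 := ltW Cb_gt0.
have S0 : 0 <= b ^+ 2 + Q ^+ 2 + eps ^+ 2 by rewrite !addr_ge0 ?sqr_ge0.
case: ifPn => [bad|]; last rewrite -leNgt => good.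
  have x0 : 0 <= (2 * (b + 6 * Q) + eps) / eps by rewrite divr_ge0 // ltW.
  have := sq _ _ x0 (h1 _ e0 _) (lexx _); rewrite /m le_max lexx => /(_ isT) /le_trans; apply.
  have -> : 8 * kap ^+ 2 * (6 * M0 / M1 + 6) ^+ 2 * Q ^+ 2 / eps ^+ 2 =
     kap ^+ 2 * (8 * ((6 * M0 / M1 + 6) * Q / eps) ^+ 2).
    by field; rewrite !gt_eqF.
  rewrite -mulrA -mulrDr ler_wpM2l ?sqr_ge0 //.
  have -> : (2 * (b + 6 * Q) + eps) / eps = 1 + 2 * ((b + 6 * Q) / eps).
    by field; rewrite gt_eqF.
  (* Here [b <= M0 / 4], and [M0 / 4 <= 6 * M0 / M1 * Q] because [Q > M1 / 24]. *)
  have hb : (b + 6 * Q) / eps <= (6 * M0 / M1 + 6) * Q / eps.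
    rewrite ler_wpM2r ?invr_ge0 ?(ltW e0) // [leRHS]mulrDl lerD2r.
    rewrite (_ : 6 * M0 / M1 * Q = M0 / 4 * (Q / (M1 / 24))); last by field; rewrite gt_eqF.
    have : 1 <= Q / (M1 / 24) by rewrite ler_pdivlMr ?divr_gt0 // mul1r ltW.
    move=> q1; apply: (@le_trans _ _ (M0 / 4)); first by lra.
    by rewrite ler_peMr // divr_ge0 // ltW.
  have hb0 : 0 <= (b + 6 * Q) / eps by rewrite divr_ge0 ?(ltW e0) // addr_ge0 // mulr_ge0.
  have h2 : ((b + 6 * Q) / eps) ^+ 2 <= ((6 * M0 / M1 + 6) * Q / eps) ^+ 2.
    by rewrite ler_sqr ?nnegrE // (le_trans hb0).
  (* The summand 1 in [1 + 2 * ((b + 6 * Q) / eps)] is absorbed by the [Ca] term, since [Q] is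
     bounded below. *)
  have h3 : 2 <= 2 / (M1 / 24) ^+ 2 * Q ^+ 2.
    rewrite mulrAC ler_pdivlMr ?exprn_gt0 ?divr_gt0 // ler_wpM2l //.
    by rewrite ler_sqr ?nnegrE ?divr_ge0 ?(ltW M10) // ltW.
  have h4 : 2 <= (1728 / M1 ^+ 2 + 2 / (M1 / 24) ^+ 2) * (b ^+ 2 + Q ^+ 2 + eps ^+ 2).
    apply: le_trans h3 _; rewrite ler_pM ?sqr_ge0 //; first by lra.
    by have := sqr_ge0 b; have := sqr_ge0 eps; lra.
  move: h4 h2 hb0; move: (_ * (b ^+ 2 + _ + _)) ((b + _) / eps) (((_ + 6) * _ / eps) ^+ 2).
  move=> u x v; have := sqr_ge0 (1 - 2 * x); nra.
have m2 : M1 / 2 <= m by rewrite /m le_max; apply/orP; right; lra.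
have m20 : 0 < M1 / 2 by rewrite divr_gt0.
have x0 : 0 <= (2 * (b + 6 * Q) + eps) / (M1 / 2) by rewrite divr_ge0 // ltW.
rewrite addr0; have := sq _ _ x0 (h1 _ m20 m2) (lexx _) => /le_trans; apply.
rewrite -mulrA ler_wpM2l ?sqr_ge0 //.
(* 1728 is [4 * 3 * 144]: the inverse square of [M1 / 2], three summands, and [12 ^ 2] as the
   largest coefficient. *)
apply: (@le_trans _ _ (1728 / M1 ^+ 2 * (b ^+ 2 + Q ^+ 2 + eps ^+ 2))); last first.
  by rewrite ler_wpM2r // lerDl.
rewrite expr_div_n (_ : (M1 / 2) ^+ 2 = M1 ^+ 2 / 4); last by field.
rewrite invf_div mulrA [leRHS]mulrAC ler_wpM2r ?invr_ge0 ?exprn_ge0 ?(ltW M10) //.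
have := sqr_ge0 (2 * b - 12 * Q); have := sqr_ge0 (2 * b - eps).
have := sqr_ge0 (12 * Q - eps); have := sqr_ge0 b; have := sqr_ge0 eps; nra.
Qed.

End RiskBound.

(** * The union bound at two scales *)

Section TaperingRisk.
Context {R : realType}.

Lemma expR_mul_abs_le (h x : R) : 0 <= h -> expR (h * `|x|) <= expR (h * x) + expR (- h * x).
Proof.
move=> h0; have := expR_ge0 (h * x); have := expR_ge0 (- h * x).
have [x0|x0] := ger0P x; first by lra.
by rewrite mulrN mulNr; lra.
Qed.

(** [Lam] stands for the logarithm of the number of signed net points; leaving it free separates the
    probabilistic estimate from the comparison of [Lam] with [k + log p]. *)
Lemma tapering_risk_bound (M0 M1 : R) : 0 < M1 -> M1 < M0 ->
  exists Ca Cb lambda : R, [/\ 0 < Ca, 0 < Cb, 0 < lambda &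
  forall (n p0 q k : nat) (alpha M eps Lam : R) (Sigma : 'M[R]_(p0 + q))
    (d : measure_display) (T : measurableType d) (P : probability T R)
    (Z : 'I_n -> {RV P >-> (p0 + q).-tuple R}),
  (0 < n)%N -> (0 < k <= p0 + q)%N -> 0 < eps -> 0 <= M -> (0 < k./2)%N ->
  bandable alpha M M0 M1 Sigma ->
  M * (k./2)%:R `^ (- alpha) <= lambda_min Sigma / 4 ->
  mutually_independent Z -> (forall i, mvnormal 0 Sigma (Z i)) ->
  1 <= Lam -> (12 * (p0 + q) * (2 ^ 18) ^ k)%:R <= expR Lam -> Lam <= lambda * n%:R ->
  ('E_P[fun w => (spectral_norm
      (psi Sigma - psi (adjusted_taper k eps (sample_cov Z w))) ^+ 2)%R]
   <= (Ca * ((M * (k./2)%:R `^ (- alpha)) ^+ 2 + eps ^+ 2 + 58 * M0 ^+ 2 * Lam / n%:R)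
       + Cb / eps ^+ 2 * expR (- (lambda * n%:R)))%:E)%E].
Proof.
move=> M10 M1M0; have M00 : 0 < M0 := lt_trans M10 M1M0.
(* [tau] is the threshold of [loss_scalar_bound], and [n * t] minimizes [4 (h M0)^2 / n - h tau]
   over [h]. The minimum is [- 2 * lambda * n]; paying [Lam <= lambda * n] for the net leaves
   [- lambda * n]. *)
pose tau := M1 / 24; pose t := tau / (8 * M0 ^+ 2).
have [Ca [Cq [Ca0 Cq0 hloss]]] := loss_scalar_bound M10 M00.
pose Cb := Cq * (2 * tau ^+ 2 + 8 / t ^+ 2).
pose lambda := tau ^+ 2 / (32 * M0 ^+ 2).
have tau0 : 0 < tau by rewrite divr_gt0.
have t0 : 0 < t by rewrite divr_gt0 // mulr_gt0 // exprn_gt0.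
have Cb0 : 0 < Cb.
  rewrite mulr_gt0 // ltr_wpDl //; first by rewrite mulr_ge0 // sqr_ge0.
  by rewrite divr_gt0 // exprn_gt0.
have lam0 : 0 < lambda by rewrite divr_gt0 ?exprn_gt0 // mulr_gt0 // exprn_gt0.
exists Ca, Cb, lambda; split=> //.
move=> n p0 q k alpha M eps Lam Sigma d T P Z n0 kp e0 M_ge0 k20 band biasl ind norm Lam1 N_le Lamn.
have p_gt0 : (0 < p0 + q)%N by case/andP: kp; exact: leq_trans.
have [s [s_size s0 s_unit hnet]] := @taper_net R (p0 + q) k kp.
have {N_le} {}s_size : (2 * size s)%:R <= expR Lam.
  apply: le_trans N_le; rewrite ler_nat; move: s_size.
  move: ((2 ^ 18) ^ k)%N => B; rewrite -(leq_pmul2l (ltn0Sn 1)) => /leq_trans; apply.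
  by rewrite !mulnA.
have nR : 0 < n%:R :> R by rewrite ltr0n.
have Lam0 : 0 < Lam by lra.
have [pd _ hmax hmin] := band; have [Sigs Sigpd] := pd.
set b := M * _ in biasl *.
have b0 : 0 <= b by rewrite mulr_ge0 // powR_ge0.
have M1l : M1 <= lambda_min Sigma by exact: hmin.
have l0 : 0 < lambda_min Sigma := lt_le_trans M10 M1l.
have quadM0 x : dot x (Sigma *m x) <= M0 * dot x x.
  by apply: le_trans (lambda_max_quad x p_gt0 Sigs) _; rewrite ler_wpM2r ?dot_ge0.
have quadl x : lambda_min Sigma * dot x x <= dot x (Sigma *m x).
  exact: lambda_min_quad.
have lM0 : lambda_min Sigma <= M0.
  have [u u1] := @unit_vector_exists R _ p_gt0.
  have := le_trans (quadl u) (quadM0 u).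
  by rewrite -!sqr_norm2 u1 expr1n !mulr1.
have SigM0 : opbound Sigma M0.
  apply: sym_quad_opbound => //; first exact: ltW.
  move=> x; rewrite ger0_norm // (le_trans _ (quadl x)) // mulr_ge0 ?dot_ge0 //.
  exact: ltW.
pose X (y : 'cV[R]_(p0 + q)) w := dot y ((sample_cov Z w - Sigma) *m y).
pose G h w := \sum_(y <- s) (expR (h * X y w) + expR (- h * X y w)).
pose v := Num.sqrt (n%:R * Lam).
(* h1 and r balance the union bound: h1 * r = 5 Lam is the sum of Lam, the
   log-cardinality of the net, and 4 Lam, the log-moment at h1. *)
pose h1 := v / M0.
pose r := 5 * M0 * (v / n%:R).
pose h2 := n%:R * t.
set loss := fun w => _.
have nL0 : 0 < n%:R * Lam by rewrite mulr_gt0.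
have v0 : 0 < v by rewrite sqrtr_gt0.
have h10 : 0 < h1 by rewrite divr_gt0.
have r0 : 0 <= r by rewrite !mulr_ge0 ?invr_ge0 ?ler0n ?(ltW M00) ?(ltW v0).
have h20 : 0 < h2 by rewrite mulr_gt0.
have th2 : t <= h2 by rewrite ler_peMl ?(ltW t0) // ler1n.
have G_ge0 h w : 0 <= G h w.
  by rewrite sumr_ge0 // => y _; rewrite addr_ge0 ?expR_ge0.
(* A measurable majorant of the squared loss, made of a constant and exponential sums over the net,
   whose expectation is computed term by term. *)
pose dom w := Ca * (b ^+ 2 + eps ^+ 2 + 2 * r ^+ 2)
   + (Ca * (8 / h1 ^+ 2) * expR (- (h1 * r)) * G h1 w
   + Cb / eps ^+ 2 * expR (- (h2 * tau)) * G h2 w).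
have loss_dom w : loss w <= dom w.
  (* The maximizing point depends on [w]; its exponential is one of the terms of [G], which also
     takes care of the absolute value by including both signs. *)
  have [y ys ymax] := seq_max_exists (fun y => `|X y w|) s0.
  pose Q := `|X y w|; have Q0 : 0 <= Q by apply: normr_ge0.
  have expQ h : 0 < h -> expR (h * Q) <= G h w.
    move=> h0; rewrite /G (big_rem y) //= -[leLHS]addr0 lerD //.
      exact: expR_mul_abs_le (ltW h0).
    by rewrite sumr_ge0 // => z _; rewrite addr_ge0 ?expR_ge0.
  have SS := sample_cov_sym Z w.
  have Es : (sample_cov Z w - Sigma)^T = sample_cov Z w - Sigma.
    by rewrite linearB /= SS Sigs.
  have hquad x : `|dot x ((taper k (sample_cov Z w) - Sigma) *m x)| <=
      (b + 6 * Q) * dot x x.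
    have -> : taper k (sample_cov Z w) - Sigma =
        taper k (sample_cov Z w - Sigma) + (taper k Sigma - Sigma).
      by rewrite taperB addrA subrK.
    rewrite mulmxDl dotDr addrC [leRHS]mulrDl.
    apply: le_trans (ler_normD _ _) _; apply: lerD; first exact: (taper_bias k20 band).
    exact: hnet.
  have d0 : 0 <= b + 6 * Q by apply: addr_ge0 b0 (mulr_ge0 (ler0n _ 6) Q0).
  have hl := adjusted_taper_loss p_gt0 SS Sigs e0 d0 l0 (ltW M00) SigM0 quadl hquad.
  have := hloss _ _ _ _ _ M1l lM0 b0 biasl Q0 e0 (spectral_norm_ge0 _) hl.
  rewrite -/tau => /le_trans; apply.
  have e1 : expR (h1 * (Q - r)) <= expR (- (h1 * r)) * G h1 w.
    by rewrite mulrBr addrC expRD ler_wpM2l ?expR_ge0 //; apply: expQ.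
  have e2 : expR (h2 * (Q - tau)) <= expR (- (h2 * tau)) * G h2 w.
    by rewrite mulrBr addrC expRD ler_wpM2l ?expR_ge0 //; apply: expQ.
  have c1 : 0 <= 8 / h1 ^+ 2 by rewrite divr_ge0 // sqr_ge0.
  have c2 : 0 <= Cb / eps ^+ 2 by rewrite divr_ge0 ?sqr_ge0 // ltW.
  rewrite /dom addrA; apply: lerD.
    rewrite -!mulrA -mulrDr ler_wpM2l ?(ltW Ca0) //.
    have := sqr_le_tail h10 r0 Q0; have := ler_wpM2l c1 e1.
    rewrite !mulrA => i1 i2; have := le_trans i2 (lerD (lexx _) i1); lra.
  case: ifPn => [tQ|_]; last exact: mulr_ge0 (mulr_ge0 c2 (expR_ge0 _)) (G_ge0 _ _).
  have := sqr_le_tail_above t0 th2 (ltW tau0) tQ => i1.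
  have i2 := le_trans i1 (ler_wpM2l _ e2).
  have -> : Cq * Q ^+ 2 / eps ^+ 2 = Cq / eps ^+ 2 * Q ^+ 2 by rewrite mulrAC.
  have -> : Cb / eps ^+ 2 * expR (- (h2 * tau)) * G h2 w =
      Cq / eps ^+ 2 * ((2 * tau ^+ 2 + 8 / t ^+ 2) * (expR (- (h2 * tau)) * G h2 w)).
    by rewrite /Cb !mulrA [in LHS](mulrAC Cq).
  apply: ler_wpM2l; first by rewrite divr_ge0 ?sqr_ge0 // ltW.
  apply: i2; apply: addr_ge0; first by rewrite mulr_ge0 ?sqr_ge0.
  by rewrite divr_ge0 ?sqr_ge0.
have mX y : measurable_fun setT (X y) by exact: measurable_sample_cov_quad.
have mE h y : measurable_fun setT (fun w => expR (h * X y w)).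
  by apply: measurableT_comp => //; apply: measurable_funM.
have mG h : measurable_fun setT (G h).
  by apply: measurable_sum => y; apply: measurable_funD.
have intG h : 0 <= h -> h * M0 <= n%:R / 4 ->
    (\int[P]_w (G h w)%:E <= (expR (Lam + 4 * (h * M0) ^+ 2 / n%:R))%:E)%E.
  move=> h0 hM; set E := expR (4 * (h * M0) ^+ 2 / n%:R).
  have iX h' y : y \in s -> `|h'| = h -> (\int[P]_w (expR (h' * X y w))%:E <= E%:E)%E.
    move=> ys h'E; have sqE : (h * M0) ^+ 2 = (h' * M0) ^+ 2.
      by rewrite -h'E !exprMn real_normK ?num_real.
    rewrite /E sqE; apply: sample_cov_mgf => //; last by rewrite h'E.
    by apply: le_trans (quadM0 y) _; rewrite ler_piMr ?s_unit // ltW.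
  rewrite /G; under eq_integral do rewrite -sumEFin.
  rewrite ge0_integral_sum; [|exact: measurableT| |]; last 2 first.
  - by move=> y; apply/measurable_EFinP/measurable_funD.
  - by move=> y w _; rewrite lee_fin addr_ge0 ?expR_ge0.
  apply: (@le_trans _ _ (\sum_(y <- s) (2 * E)%:E)%E).
    rewrite big_seq [leRHS]big_seq; apply: lee_sum => y ys.
    under eq_integral do rewrite EFinD.
    rewrite ge0_integralD; [|exact: measurableT| | | |]; last 4 first.
    - by move=> w _; rewrite lee_fin expR_ge0.
    - exact/measurable_EFinP.
    - by move=> w _; rewrite lee_fin expR_ge0.
    - exact/measurable_EFinP.
    have -> : (2 * E)%:E = (E%:E + E%:E)%E by rewrite -EFinD; congr EFin; ring.
    by apply: leeD; apply: iX => //; rewrite ?normrN ger0_norm.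
  rewrite sumEFin big_const_seq count_predT iter_addr_0 lee_fin expRD -mulrnAl.
  rewrite ler_wpM2r ?expR_ge0 //; apply: le_trans s_size.
  by rewrite natrM mulr_natr.
rewrite unlock; apply: (@le_trans _ _ (\int[P]_w (dom w)%:E)%E).
  apply: integral_le_dominating => w; first by rewrite lee_fin sqr_ge0.
  by rewrite lee_fin loss_dom.
have c1 : 0 <= Ca * (b ^+ 2 + eps ^+ 2 + 2 * r ^+ 2).
  apply: mulr_ge0 (ltW Ca0) _; rewrite !addr_ge0 ?sqr_ge0 //.
  by rewrite mulr_ge0 ?sqr_ge0.
have c2 : 0 <= Ca * (8 / h1 ^+ 2) * expR (- (h1 * r)).
  apply: mulr_ge0 (expR_ge0 _); apply: mulr_ge0 (ltW Ca0) _.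
  by rewrite divr_ge0 ?sqr_ge0.
have c3 : 0 <= Cb / eps ^+ 2 * expR (- (h2 * tau)).
  by rewrite mulr_ge0 ?expR_ge0 // divr_ge0 ?sqr_ge0 // ltW.
have mcG c h : measurable_fun setT (fun w => (c * G h w)%:E).
  by apply/measurable_EFinP/measurable_funM.
have intcG c h : 0 <= c -> (\int[P]_w (c * G h w)%:E = c%:E * \int[P]_w (G h w)%:E)%E.
  move=> c0; under eq_integral do rewrite EFinM.
  rewrite ge0_integralZl //; first exact/measurable_EFinP.
  by move=> w _; rewrite lee_fin.
have -> : (\int[P]_w (dom w)%:E = (Ca * (b ^+ 2 + eps ^+ 2 + 2 * r ^+ 2))%:E +
    ((Ca * (8 / h1 ^+ 2) * expR (- (h1 * r)))%:E * \int[P]_w (G h1 w)%:E +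
     (Cb / eps ^+ 2 * expR (- (h2 * tau)))%:E * \int[P]_w (G h2 w)%:E))%E.
  under eq_integral do rewrite /dom EFinD EFinD.
  rewrite ge0_integralD //; last 2 first.
  - by move=> w _; rewrite -EFinD lee_fin addr_ge0 //; apply: mulr_ge0 (G_ge0 _ _).
  - by apply: emeasurable_funD.
  rewrite ge0_integralD //; last 2 first.
  - by move=> w _; rewrite lee_fin mulr_ge0.
  - by move=> w _; rewrite lee_fin mulr_ge0.
  rewrite !intcG //; congr (_ + _)%E.
  by rewrite integral_cst // -[RHS]mule1; congr (_ * _)%E; exact: probability_setT.
have tauM0 : tau <= M0 by rewrite /tau; lra.
have lam32 : lambda <= 32^-1.
  rewrite ler_pdivrMr ?mulr_gt0 ?exprn_gt0 // mulKf // ler_sqr ?nnegrE //; exact: ltW.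
have v2 : v ^+ 2 = n%:R * Lam by rewrite sqr_sqrtr // ltW.
have h1M0 : h1 * M0 = v by rewrite divfK // gt_eqF.
have h1r : h1 * r = 5 * Lam.
  have -> : h1 * r = 5 * v ^+ 2 / n%:R by rewrite /h1 /r; field; rewrite !gt_eqF.
  by rewrite v2; field; rewrite gt_eqF.
have I1 : (\int[P]_w (G h1 w)%:E <= (expR (h1 * r))%:E)%E.
  have -> : h1 * r = Lam + 4 * (h1 * M0) ^+ 2 / n%:R.
    by rewrite h1r h1M0 v2; field; rewrite gt_eqF.
  apply: intG; first exact: ltW.
  (* The range condition is [v <= n / 4], and [v ^+ 2 = n * Lam <= n ^ 2 / 32]. *)
  rewrite h1M0 -ler_sqr ?nnegrE ?(ltW v0) ?divr_ge0 // v2.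
  have : Lam <= n%:R / 32 by rewrite (le_trans Lamn) // mulrC ler_wpM2l.
  move=> LamR; apply: (@le_trans _ _ (n%:R * (n%:R / 32))); first by rewrite ler_wpM2l.
  have := sqr_ge0 (n%:R : R); lra.
have I2 : (\int[P]_w (G h2 w)%:E <= (expR (h2 * tau - lambda * n%:R))%:E)%E.
  apply: (@le_trans _ _ (expR (Lam + 4 * (h2 * M0) ^+ 2 / n%:R))%:E).
    apply: intG; first exact: ltW.
    rewrite /h2 -mulrA ler_wpM2l //.
    have -> : t * M0 = tau / M0 / 8 by rewrite /t; field; rewrite gt_eqF.
    have : tau / M0 <= 1 by rewrite ler_pdivrMr // mul1r.
    lra.
  rewrite lee_fin ler_expR.
  have -> : 4 * (h2 * M0) ^+ 2 / n%:R = 2 * (lambda * n%:R).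
    by rewrite /h2 /t /lambda; field; rewrite !gt_eqF.
  have -> : h2 * tau = 4 * (lambda * n%:R).
    by rewrite /h2 /t /lambda; field; rewrite !gt_eqF.
  lra.
apply: (@le_trans _ _ ((Ca * (b ^+ 2 + eps ^+ 2 + 2 * r ^+ 2))%:E +
    ((Ca * (8 / h1 ^+ 2) * expR (- (h1 * r)))%:E * (expR (h1 * r))%:E +
     (Cb / eps ^+ 2 * expR (- (h2 * tau)))%:E * (expR (h2 * tau - lambda * n%:R))%:E))%E).
  apply: leeD => //; apply: leeD; exact: lee_wpmul2l.
rewrite -!EFinM -!EFinD lee_fin.
have -> : Ca * (8 / h1 ^+ 2) * expR (- (h1 * r)) * expR (h1 * r) = Ca * (8 / h1 ^+ 2).
  by rewrite -mulrA -expRD addNr expR0 mulr1.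
have -> : Cb / eps ^+ 2 * expR (- (h2 * tau)) * expR (h2 * tau - lambda * n%:R) =
    Cb / eps ^+ 2 * expR (- (lambda * n%:R)).
  by rewrite -mulrA -expRD; congr (_ * expR _); ring.
rewrite addrA lerD2r -mulrDr ler_wpM2l ?(ltW Ca0) //.
(* The final 58 is 50 from [2 * r ^+ 2] plus 8 from [8 / h1 ^+ 2], the latter using [1 <= Lam]. *)
have -> : 2 * r ^+ 2 = 50 * (M0 ^+ 2 * Lam / n%:R).
  have -> : r ^+ 2 = 25 * M0 ^+ 2 * (v ^+ 2 / n%:R ^+ 2).
    by rewrite /r; field; rewrite gt_eqF.
  by rewrite v2; field; rewrite gt_eqF.
have : 8 / h1 ^+ 2 <= 8 * (M0 ^+ 2 * Lam / n%:R).
  have -> : h1 ^+ 2 = n%:R * Lam / M0 ^+ 2.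
    by rewrite /h1 expr_div_n v2.
  rewrite invf_div -[M0 ^+ 2 * Lam / _]mulrA ler_wpM2l // ler_wpM2l ?sqr_ge0 //.
  rewrite invfM mulrC ler_wpM2r ?invr_ge0 ?ler0n //.
  by rewrite (le_trans _ Lam1) // invf_le1.
lra.
Qed.

End TaperingRisk.

(** * Rates in [k] and the size of the net *)

Section Constants.
Context {R : realType}.

Lemma half_ge_third (k : nat) : (0 < k./2)%N -> (k <= 3 * k./2)%N.
Proof. by have := odd_double_half k; case: (odd k); lia. Qed.

Lemma taper_bias_rate (alpha : R) (k : nat) : 0 < alpha -> (0 < k./2)%N ->
  ((k./2)%:R `^ (- alpha)) ^+ 2 <= (3 `^ alpha) ^+ 2 * k%:R `^ (- (2 * alpha)) :> R.
Proof.
move=> a0 k2; have K0 : 0 < (k./2)%:R :> R by rewrite ltr0n.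
have k0 : 0 < k%:R :> R by rewrite ltr0n; have := odd_double_half k; lia.
have kK : k%:R <= 3 * (k./2)%:R :> R by rewrite -natrM ler_nat half_ge_third.
have -> : k%:R `^ (- (2 * alpha)) = (k%:R `^ (- alpha)) ^+ 2 :> R.
  rewrite expr2 -powRD; last by rewrite (gt_eqF k0) implybT.
  by congr (_ `^ _); ring.
rewrite -exprMn ler_sqr ?nnegrE ?mulr_ge0 ?powR_ge0 //.
rewrite !powRN ler_pdivlMr ?powR_gt0 // mulrC ler_pdivrMr ?powR_gt0 //.
rewrite -powRM ?ler0n //.
by apply: ge0_ler_powR; rewrite ?nnegrE ?mulr_ge0 ?ler0n ?(ltW a0).
Qed.

(** The condition on [k] says that the bias is at most a quarter of the smallest eigenvalue, as
    [loss_scalar_bound] demands. *)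
Lemma taper_bias_small (alpha M l : R) (K : nat) : 0 < alpha -> 0 < M -> 0 < l ->
  (4 * M / l) `^ alpha^-1 < K%:R -> M * K%:R `^ (- alpha) <= l / 4.
Proof.
move=> a0 M0 l0 hK; have K0 : 0 < K%:R :> R := le_lt_trans (powR_ge0 _ _) hK.
have x0 : 0 <= 4 * M / l by rewrite divr_ge0 ?mulr_ge0 // ltW.
have : ((4 * M / l) `^ alpha^-1) `^ alpha <= K%:R `^ alpha.
  by apply: ge0_ler_powR; rewrite ?nnegrE ?powR_ge0 // ltW.
rewrite -powRrM mulVf ?gt_eqF // powRr1 // ler_pdivrMr // => h.
rewrite powRN ler_pdivrMr ?powR_gt0 //.
by move: h; set x := _ `^ _; lra.
Qed.

(** The 12 is the 6 of [taper_net] doubled for the two signs; a single [c] absorbs the base in the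
    factor [k] and dominates 1 in the factor [ln p]. *)
Lemma net_size_le_exp (c : R) (p k : nat) : 12 * 2 ^+ 18 <= c -> 1 <= c ->
  (0 < p)%N -> (0 < k)%N ->
  (12 * p * (2 ^ 18) ^ k)%:R <= expR (c * (k%:R + ln p%:R)).
Proof.
move=> cB c1 p0 k0; have pR : 1 <= p%:R :> R by rewrite ler1n.
have p_gt0 : 0 < p%:R :> R by rewrite ltr0n.
have -> : (12 * p * (2 ^ 18) ^ k)%:R = 12 * (2 ^+ 18) ^+ k * p%:R :> R.
  by rewrite !natrM !natrX mulrAC.
rewrite mulrDr expRD; apply: ler_pM => //.
- apply: (@le_trans _ _ ((12 * 2 ^+ 18) ^+ k)).
    rewrite [leRHS]exprMn ler_wpM2r ?exprn_ge0 ?ler0n //.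
    by rewrite -[leLHS]expr1; apply: ler_weXn2l => //; rewrite ler1n.
  rewrite [c * _]mulrC expRM_natl lerXn2r ?nnegrE ?expR_ge0 //.
  apply: le_trans cB (le_trans _ (expR_ge1Dx c)); by rewrite lerDr.
- rewrite -[leLHS]lnK ?posrE // ler_expR ler_peMl // ln_ge0 //.
Qed.

End Constants.

Theorem theorem2p2 (R : realType) (alpha M M0 M1 : R)
  (alpha_gt0 : 0 < alpha) (M_gt0 : 0 < M) (M1_gt0 : 0 < M1) (M1_lt_M0 : M1 < M0) :
  exists C lambda : R, 0 < C /\ 0 < lambda /\
  forall (p0 q k : nat -> nat) (eps : nat -> R)
    (Sigma0 : forall n : nat, 'M[R]_(p0 n + q n))
    (d : nat -> measure_display) (T : forall n : nat, measurableType (d n))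
    (P : forall n : nat, probability (T n) R)
    (Z : forall n : nat, 'I_n -> {RV (P n) >-> (p0 n + q n).-tuple R}),
  let p := fun n : nat => (p0 n + q n)%N in
  (forall n : nat, (0 < n)%N ->
    (0 < k n)%N /\ (k n < p0 n)%N /\ (p0 n < p n)%N /\ 0 < eps n /\
    bandable alpha M M0 M1 (Sigma0 n) /\
    mutually_independent (Z n) /\
    (forall i : 'I_n, mvnormal 0 (Sigma0 n) (Z n i))) ->
  (fun n : nat => Num.max (k n)%:R (ln (p n)%:R) : R^o) =o_\oo
    (fun n : nat => n%:R : R^o) ->
  (eps : nat -> R^o) =O_\oo (fun _ : nat => 1 : R^o) ->
  (forall n : nat, (0 < n)%N ->
    (4 * M / lambda_min (Sigma0 n)) `^ (alpha^-1) < ((k n)./2)%:R) ->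
  \forall n \near \oo,
    ('E_(P n)[fun w => (spectral_norm
        (psi (Sigma0 n) - psi (adjusted_taper (k n) (eps n) (sample_cov (Z n) w)))
        ^+ 2)%R]
      <= (C * ((k n)%:R `^ (- (2 * alpha))
               + ((k n)%:R + ln (p n)%:R) / n%:R
               + eps n ^+ 2
               + (p n)%:R `^ (2^-1) * 5 `^ ((k n)%:R / 2) * expR (- (lambda * n%:R))
                 / eps n ^+ 2))%:E)%E.
Proof.
have M0_gt0 : 0 < M0 := lt_trans M1_gt0 M1_lt_M0.
have [Ca [Cb [lambda [Ca0 Cb0 lambda0 risk]]]] := tapering_risk_bound M1_gt0 M1_lt_M0.
have [c c_ge1 cB] : exists2 c : R, 1 <= c & 12 * 2 ^+ 18 <= c.
  by exists (Num.max 1 (12 * 2 ^+ 18)); rewrite le_max lexx // orbT.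
have c0 : 0 < c by apply: lt_le_trans c_ge1.
pose a1 := M ^+ 2 * (3 `^ alpha) ^+ 2; pose a2 := 58 * M0 ^+ 2 * c.
have a1_ge0 : 0 <= a1 by rewrite mulr_ge0 ?sqr_ge0.
have a2_ge0 : 0 <= a2 by apply: mulr_ge0 (ltW c0); rewrite mulr_ge0 ?sqr_ge0.
exists (Ca * (a1 + 1 + a2) + Cb), lambda; split.
  by rewrite ltr_wpDl // mulr_ge0 ?(ltW Ca0) // !addr_ge0.
split=> // p0 q k eps Sigma0 d T P Z p hyp ho _ hk.
(* With this threshold [k] and [ln p] are each eventually at most [lambda * n / (2 * c)], so that
   [c * (k + ln p) <= lambda * n]. *)
have eta0 : 0 < lambda / (2 * c) by rewrite divr_gt0 // mulr_gt0.
have /eqoP/(_ _ eta0) hn := ho.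
near=> n.
have n0 : (0 < n)%N by near: n; exact: nbhs_infty_gt.
have [k0 [kp0 [p0p [e0 [band [ind norm]]]]]] := hyp n n0.
have nR : 0 < n%:R :> R by rewrite ltr0n.
have [pd _ _ lmin] := band.
have l0 : 0 < lambda_min (Sigma0 n) by apply: lt_le_trans lmin.
have K0 : (0 < (k n)./2)%N.
  by rewrite -(ltr0n R); apply: le_lt_trans (hk n n0); exact: powR_ge0.
have p_gt0 : (0 < p n)%N by apply: leq_ltn_trans p0p.
have lnp : 0 <= ln (p n)%:R :> R by rewrite ln_ge0 // ler1n.
have k1 : 1 <= (k n)%:R :> R by rewrite ler1n.
pose L : R := (k n)%:R + ln (p n)%:R.
have Lam1 : 1 <= c * L.
  by rewrite -[1]mulr1 ler_pM // /L; lra.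
have Lamn : c * L <= lambda * n%:R.
  have : `|Num.max (k n)%:R (ln (p n)%:R) : R^o| <= lambda / (2 * c) * `|n%:R : R^o|.
    by near: n.
  rewrite (ger0_norm (ltW nR)) => /(le_trans (ler_norm _)).
  rewrite ge_max => /andP [h1 h2].
  have -> : lambda * n%:R = c * (2 * (lambda / (2 * c) * n%:R)).
    by field; rewrite gt_eqF.
  by rewrite ler_wpM2l ?(ltW c0) // /L; lra.
have kp : (0 < k n <= p0 n + q n)%N.
  by rewrite k0 (leq_trans (ltnW kp0)) // leq_addr.
have := risk n (p0 n) (q n) (k n) alpha M (eps n) (c * L) (Sigma0 n) (d n) (T n) (P n) (Z n)
  n0 kp e0 (ltW M_gt0) K0 band (taper_bias_small alpha_gt0 M_gt0 l0 (hk n n0)) ind norm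
  Lam1 (net_size_le_exp cB c_ge1 p_gt0 k0) Lamn.
move=> /le_trans; apply; rewrite lee_fin.
set A := (k n)%:R `^ (- (2 * alpha)).
set B := ((k n)%:R + _) / n%:R.
set E := _ * expR _ / eps n ^+ 2.
have A0 : 0 <= A by exact: powR_ge0.
have B0 : 0 <= B by rewrite divr_ge0 ?(ltW nR) // addr_ge0.
have D0 : 0 <= eps n ^+ 2 by exact: sqr_ge0.
have E0 : 0 <= E.
  by apply: divr_ge0 D0; rewrite !mulr_ge0 ?powR_ge0 ?expR_ge0.
have hA : (M * ((k n)./2)%:R `^ (- alpha)) ^+ 2 <= a1 * A.
  by rewrite exprMn /a1 -mulrA ler_wpM2l ?sqr_ge0 // taper_bias_rate.
have hB : 58 * M0 ^+ 2 * (c * L) / n%:R = a2 * B by rewrite /a2 /B /L !mulrA.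
(* The net has already been paid for by part of the exponent, and [p^(1/2) 5^(k/2) >= 1]. *)
have hE : Cb / eps n ^+ 2 * expR (- (lambda * n%:R)) <= Cb * E.
  rewrite -mulrA ler_wpM2l ?(ltW Cb0) // /E mulrC ler_wpM2r ?invr_ge0 //.
  rewrite -[leLHS]mul1r ler_wpM2r ?expR_ge0 // mulr_ege1 //.
    by rewrite -[leLHS](powRr0 (p n)%:R) ler_powR ?ler1n ?invr_ge0.
  by rewrite -[leLHS](powRr0 5) ler_powR ?ler1n ?divr_ge0.
have step : Ca * ((M * ((k n)./2)%:R `^ (- alpha)) ^+ 2 + eps n ^+ 2
      + 58 * M0 ^+ 2 * (c * L) / n%:R)
    <= Ca * (a1 * A + eps n ^+ 2 + a2 * B).
  by rewrite ler_wpM2l ?(ltW Ca0) // hB !lerD2r.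
apply: le_trans (lerD step hE) _.
set D := eps n ^+ 2 in D0 *; rewrite -subr_ge0.
set rhs := (X in 0 <= X).
have -> : rhs = Ca * (a1 * (B + D + E) + (A + B + E) + a2 * (A + D + E)) + Cb * (A + B + D).
  by rewrite /rhs; ring.
by rewrite addr_ge0 // mulr_ge0 ?(ltW Ca0) ?(ltW Cb0) // !addr_ge0 // mulr_ge0 // !addr_ge0.
Unshelve. all: by end_near.
Qed.
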